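(* Let $L\ge 1$, $m\ge 2$ and $$K^m_{\ell_2}=\operatorname{cl}\Big\{(\mathbf{X}_1,\ldots,\mathbf{X}_m)\in\mathbb{S}^L_{++}\times(\mathbb{R}^{L\times L})^{m-1} : \mathbf{X}_1-\sum_{i=2}^m\mathbf{X}_i\mathbf{X}_1^{-1}\mathbf{X}_i^\top\succ 0\Big\}.$$ Then $\hat F(\mathbf{X}_1,\ldots,\mathbf{X}_m)=-\log\det\big(\mathbf{X}_1-\sum_{i=2}^m\mathbf{X}_i\mathbf{X}_1^{-1}\mathbf{X}_i^\top\big)-\log\det\mathbf{X}_1$, defined on the set where both matrices are positive definite, is a $2L$-self-concordant barrier for $K^m_{\ell_2}$.
   Context: $\mathbb{S}^L$, $\mathbb{S}^L_{++}$ denote the real symmetric and positive definite $L\times L$ matrices. A function $F$ on the interior of a closed convex set $K$ with nonempty interior is a $\nu$-self-concordant barrier if it is $C^3$ and convex, $F(\mathbf{x}_k)\to\infty$ whenever $\mathbf{x}_k$ converges to a boundary point of $K$, and for all interior $\mathbf{x}$ and directions $\mathbf{h}$: $|D^3F(\mathbf{x})[\mathbf{h},\mathbf{h},\mathbf{h}]|\le 2(D^2F(\mathbf{x})[\mathbf{h},\mathbf{h}])^{3/2}$ and $(DF(\mathbf{x})[\mathbf{h}])^2\le\nu\, D^2F(\mathbf{x})[\mathbf{h},\mathbf{h}]$. *)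

(* Defs.v *)
From HB Require Import structures.
From mathcomp Require Import all_boot all_order all_algebra.
From mathcomp Require Import all_classical all_reals all_analysis.
Set Implicit Arguments. Unset Strict Implicit. Unset Printing Implicit Defensive.
Import Order.TTheory GRing.Theory Num.Theory.
Import numFieldNormedType.Exports.
Local Open Scope classical_set_scope.
Local Open Scope ring_scope.

Definition posdef {R : realType} (n : nat) (A : 'M[R]_n) : Prop :=
  A^T = A /\ forall v : 'rV[R]_n, v != 0 -> 0 < (v *m A *m v^T) ord0 ord0.

Section Barrier.
Context {R : realType} {V : normedModType R}.

Definition relint (E K : set V) : set V :=
  [set x | K x /\ exists2 e : R, 0 < e & forall y, E y -> ball x e y -> K y].

(* nu-self-concordant barrier for K (with K contained in the linear space E,
   directions h ranging over E).  D^k F(x)[h,..,h] is the iterated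
   directional derivative 'D_h ... 'D_h F x.  C^3 is expressed as existence
   and continuity (on the open domain) of all iterated directional
   derivatives of order <= 3 along directions of E. *)
Definition self_concordant_barrier (E K : set V) (F : V -> R) (nu : R) : Prop :=
  let D := relint E K in
  [/\
      ({within D, continuous F} /\
       (forall h1, E h1 -> forall x, D x -> derivable F x h1) /\
       (forall h1, E h1 -> {within D, continuous ('D_h1 F)}) /\
       (forall h1 h2, E h1 -> E h2 -> forall x, D x ->
           derivable ('D_h1 F) x h2) /\
       (forall h1 h2, E h1 -> E h2 -> {within D, continuous ('D_h2 ('D_h1 F))}) /\
       (forall h1 h2 h3, E h1 -> E h2 -> E h3 -> forall x, D x ->
           derivable ('D_h2 ('D_h1 F)) x h3) /\
       (forall h1 h2 h3, E h1 -> E h2 -> E h3 ->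
           {within D, continuous ('D_h3 ('D_h2 ('D_h1 F)))})),
      (forall x y (t : R), D x -> D y -> 0 <= t <= 1 ->
         F ((1 - t) *: x + t *: y) <= (1 - t) * F x + t * F y),
      (forall (u : nat -> V) (x : V), (forall k, D (u k)) ->
         closure K x -> ~ D x -> u @ \oo --> x -> (F \o u) @ \oo --> +oo),
      (forall x h, D x -> E h ->
         `|'D_h ('D_h ('D_h F)) x| <= 2 * ('D_h ('D_h F) x) `^ (3%:R / 2)) &
      (forall x h, D x -> E h -> ('D_h F x) ^+ 2 <= nu * 'D_h ('D_h F) x)].

End Barrier.

Section Kl2.
Context {R : realType} (L n : nat).
(* A point (X_1, X_2, ..., X_{n+1}) is stored as (X_1, Y) where Y stacks
   X_2, ..., X_{n+1} vertically; n = m - 1. *)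
Local Notation V := ('M[R]_L * 'M[R]_(n * L, L))%type.

(* Xi Z i = X_{i+2} *)
Definition Xi (Z : V) (i : 'I_n) : 'M[R]_L :=
  \matrix_(j, k) Z.2 (mxvec_index i j) k.

Definition schurL2 (Z : V) : 'M[R]_L :=
  Z.1 - \sum_(i < n) (Xi Z i *m invmx Z.1 *m (Xi Z i)^T).

Definition Espace : set V := [set Z | Z.1^T = Z.1].

Definition Kl2_inner : set V := [set Z | posdef Z.1 /\ posdef (schurL2 Z)].

Definition Kl2 : set V := closure Kl2_inner.

Definition Fhat (Z : V) : R := - ln (\det (schurL2 Z)) - ln (\det Z.1).

End Kl2.

(* Main.v *)
Require Import Defs.
From HB Require Import structures.
From mathcomp Require Import all_boot all_order all_algebra.
From mathcomp Require Import all_classical all_reals all_analysis.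
From mathcomp Require Import perm ring lra.
Set Implicit Arguments. Unset Strict Implicit. Unset Printing Implicit Defensive.
Import Order.TTheory GRing.Theory Num.Theory.
Import numFieldNormedType.Exports.
Local Open Scope classical_set_scope.
Local Open Scope ring_scope.

(* Along a line [Z + t h], put [W_i = X_i X_1^-1] and [D_i = H_i - W_i H_1].
   The Schur complement S satisfies
     S'' = - 2 sum_i D_i X_1^-1 D_i^T,
     S''' = 6 sum_i D_i X_1^-1 H_1 X_1^-1 D_i^T.
   Factor [S^-1 = g^T g] and [X_1^-1 = j^T j], and let a, c, q_i be the Frobenius
   norms of [g S' g^T], [j H_1 j^T] and [g D_i j^T]. With [b = 2 sum_i q_i ^ 2],
   Cauchy-Schwarz and submultiplicativity of the Frobenius norm give
     F'' = a^2 + b + c^2,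
     F'^2 <= 2 L (a^2 + c^2),
     |F'''| <= 2 a^3 + 3 a b + 3 c b + 2 c^3,
   and the last bound is at most [2 (F'')^(3/2)].
   By completing squares, the cone is cut out by strict inequalities that are
   linear in the point, so it is convex, and being relatively open it is the
   relative interior of its closure. At a boundary point [det S * det X_1] tends
   to 0: either [det X_1] does, while the entries of S stay bounded by those of
   X_1, or S is continuous there and becomes singular. *)

(** * Frobenius norm and positive definite matrices *)

Section Frobenius.
Context {R : rcfType}.

(** Lagrange's identity: the double sum of the squares [(a i * b j - a j * b i) ^+ 2] is twice the
    gap between the two sides. *)
Lemma cauchy_schwarz_sum (I : finType) (a b : I -> R) :
  (\sum_i a i * b i) ^+ 2 <= (\sum_i a i ^+ 2) * (\sum_i b i ^+ 2).
Proof.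
have : 0 <= \sum_i \sum_j (a i * b j - a j * b i) ^+ 2.
  by apply: sumr_ge0 => i _; apply: sumr_ge0 => j _; exact: sqr_ge0.
have -> : \sum_i \sum_j (a i * b j - a j * b i) ^+ 2 =
    ((\sum_i a i ^+ 2) * (\sum_i b i ^+ 2) - (\sum_i a i * b i) ^+ 2) *+ 2.
  rewrite mulr2n expr2 -{2}[_ * \sum_i b i ^+ 2]mulrC !big_distrlr /=.
  rewrite addrACA -opprD -!big_split -sumrB /=; apply: eq_bigr => i _.
  rewrite -!big_split -sumrB /=; apply: eq_bigr => j _; ring.
by rewrite pmulrn_lge0// subr_ge0.
Qed.

Definition frob m n (A : 'M[R]_(m, n)) : R := Num.sqrt (\tr (A *m A^T)).

Lemma mxtrace_mul_tr m n (A B : 'M[R]_(m, n)) :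
  \tr (A *m B^T) = \sum_(ij : 'I_m * 'I_n) A ij.1 ij.2 * B ij.1 ij.2.
Proof.
rewrite -(pair_bigA _ (fun i j => A i j * B i j)) /=; apply: eq_bigr => i _.
by rewrite mxE; apply: eq_bigr => j _; rewrite mxE.
Qed.

Lemma mxtrace_sqr m n (A : 'M[R]_(m, n)) :
  \tr (A *m A^T) = \sum_(ij : 'I_m * 'I_n) A ij.1 ij.2 ^+ 2.
Proof. by rewrite mxtrace_mul_tr. Qed.

Lemma mxtrace_sqr_ge0 m n (A : 'M[R]_(m, n)) : 0 <= \tr (A *m A^T).
Proof. by rewrite mxtrace_sqr sumr_ge0// => i _; exact: sqr_ge0. Qed.

Lemma frob_ge0 m n (A : 'M[R]_(m, n)) : 0 <= frob A.
Proof. exact: sqrtr_ge0. Qed.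

Lemma sqr_frob m n (A : 'M[R]_(m, n)) : frob A ^+ 2 = \tr (A *m A^T).
Proof. by rewrite sqr_sqrtr// mxtrace_sqr_ge0. Qed.

Lemma frob_tr m n (A : 'M[R]_(m, n)) : frob A^T = frob A.
Proof. by rewrite /frob trmxK mxtrace_mulC. Qed.

Lemma frob_mxtrace m n (A B : 'M[R]_(m, n)) :
  `|\tr (A *m B^T)| <= frob A * frob B.
Proof.
rewrite -ler_sqr ?nnegrE ?mulr_ge0 ?frob_ge0//.
rewrite exprMn !sqr_frob real_normK ?num_real// !mxtrace_sqr mxtrace_mul_tr.
exact: cauchy_schwarz_sum.
Qed.

(** Cauchy-Schwarz for each entry of the product, a row of [A] against a column of [B]. *)
Lemma frobM m n p (A : 'M[R]_(m, n)) (B : 'M[R]_(n, p)) :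
  frob (A *m B) <= frob A * frob B.
Proof.
rewrite -ler_sqr ?nnegrE ?mulr_ge0 ?frob_ge0//.
rewrite exprMn -(frob_tr B) !sqr_frob !mxtrace_sqr.
rewrite -(pair_bigA _ (fun i j => (A *m B) i j ^+ 2)).
rewrite -(pair_bigA _ (fun i j => A i j ^+ 2)).
rewrite -(pair_bigA _ (fun i j => B^T i j ^+ 2)) /= big_distrlr /=.
apply: ler_sum => i _; apply: ler_sum => j _; rewrite mxE.
apply: le_trans (cauchy_schwarz_sum _ _) _.
by under [X in _ <= _ * X]eq_bigr do rewrite mxE.
Qed.

Lemma frob_mxtrace_conj m n (Q : 'M[R]_(m, n)) (C : 'M[R]_n) :
  `|\tr (Q *m C *m Q^T)| <= frob C * frob Q ^+ 2.
Proof.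
apply: le_trans (frob_mxtrace _ _) _.
by rewrite expr2 mulrA ler_wpM2r ?frob_ge0// mulrC frobM.
Qed.

Lemma frob_mxtrace_cube n (A : 'M[R]_n) :
  A^T = A -> `|\tr (A *m A *m A)| <= frob A ^+ 3.
Proof. by move=> sA; rewrite -{3}sA exprS; exact: frob_mxtrace_conj. Qed.

(** Cauchy-Schwarz against the identity, whose squared norm is [n]; the factor [L] in the barrier
    parameter comes from here. *)
Lemma sqr_mxtrace n (A : 'M[R]_n) : (\tr A) ^+ 2 <= n%:R * frob A ^+ 2.
Proof.
rewrite -[A]mulmx1 -{1}(trmx1 R n) -[leLHS]real_normK ?num_real//.
apply: le_trans (_ : (frob A * frob (1%:M : 'M[R]_n)) ^+ 2 <= _).
  by rewrite ler_sqr ?nnegrE ?mulr_ge0 ?frob_ge0// frob_mxtrace.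
rewrite exprMn [X in _ * X <= _]sqr_frob trmx1 !mulmx1 mxtrace_scalar.
by rewrite mulrC.
Qed.

End Frobenius.

(** * Positive definite matrices and their Cholesky factors *)

Section PositiveDefinite.
Context {R : realType}.

Lemma mulmx_row_tr n (v : 'rV[R]_n) :
  (v *m v^T) ord0 ord0 = \sum_i v ord0 i ^+ 2.
Proof. by rewrite mxE; apply: eq_bigr => i _; rewrite mxE. Qed.

Lemma posdef_ge0 n (A : 'M[R]_n) (v : 'rV[R]_n) :
  posdef A -> 0 <= (v *m A *m v^T) ord0 ord0.
Proof.
move=> [_ pA]; have [->|/pA/ltW//] := eqVneq v 0.
by rewrite !mul0mx mxE.
Qed.

Lemma posdef_unit n (A : 'M[R]_n) : posdef A -> A \in unitmx.
Proof.
move=> [_ pA]; rewrite unitmxE unitfE; apply/negP => /det0P[v v0 vA].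
by have := pA v v0; rewrite vA mul0mx mxE ltxx.
Qed.

Lemma posdef_congr n (P B : 'M[R]_n) :
  P \in unitmx -> posdef (P *m B *m P^T) -> posdef B.
Proof.
move=> uP [sB pB].
have uP' : P^T \in unitmx by rewrite unitmx_tr.
split=> [|v v0].
  apply: (can_inj (mulKmx uP)); apply: (can_inj (mulmxK uP')).
  by rewrite -[RHS]sB !trmx_mul trmxK mulmxA.
have := pB (v *m invmx P); rewrite trmx_mul trmx_inv !mulmxA mulmxKV//.
rewrite mulmxK//; apply; apply: contra v0 => /eqP vP.
by rewrite -(mulmxKV uP v) vP mul0mx.
Qed.

Lemma posdef_drsubmx m n (A : 'M[R]_(m + n)) : posdef A -> posdef (drsubmx A).
Proof.
move=> [sA pA]; split=> [|w w0]; first by rewrite trmx_drsub sA.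
have := pA (row_mx 0 w); rewrite -{1}[A]submxK mul_row_block !mul0mx !add0r.
rewrite tr_row_mx mul_row_col trmx0 mulmx0 add0r; apply.
by apply: contra w0 => /eqP/(congr1 rsubmx); rewrite row_mxKr linear0 => ->.
Qed.

(** Gaussian elimination, by induction on the size: a unit triangular [P] makes [A] congruent to the
    block diagonal of its pivot [a] and the Schur complement [D], which inherits positive
    definiteness. *)
Lemma cholesky_ex n (A : 'M[R]_n) : posdef A -> exists G : 'M[R]_n, A = G *m G^T.
Proof.
elim: n A => [A _|n IH A]; first by exists 0; apply/matrixP => -[].
rewrite -[n.+1]/(1 + n)%N in A * => pA.
set a := A (lshift n ord0) (lshift n ord0).
have a0 : 0 < a.
  (* The pivot is the value of the form at the first basis vector. *)
  have := pA.2 (row_mx 1%:M 0); rewrite -[X in _ *m X *m _]submxK mul_row_block.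
  rewrite !mul1mx !mul0mx !addr0 tr_row_mx mul_row_col trmx0 mulmx0 addr0.
  rewrite trmx1 mulmx1 mxE mxE; apply; apply/eqP => /(congr1 lsubmx).
  by rewrite row_mxKl linear0 => /matrixP/(_ 0 0)/eqP; rewrite !mxE oner_eq0.
have ulE : ulsubmx A = a%:M.
  by apply/matrixP => i j; rewrite !ord1 !mxE eqxx.
set b := ursubmx A.
have dlE : dlsubmx A = b^T by rewrite /b trmx_ursub pA.1.
set P : 'M[R]_(1 + n) := block_mx 1%:M 0 (a^-1 *: b^T) 1%:M.
set D := drsubmx A - a^-1 *: (b^T *m b).
have uP : P \in unitmx by rewrite unitmxE det_lblock !det1 mulr1 unitr1.
have AE : A = P *m block_mx a%:M 0 0 D *m P^T.
  rewrite -{1}[A]submxK ulE dlE -/b tr_block_mx !mulmx_block.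
  rewrite !trmx0 !trmx1 !mul0mx !mulmx0 !mulmx1 !mul1mx !addr0 !add0r.
  rewrite linearZ /= trmxK -!scalemxAl -!scalemxAr mul_scalar_mx mul_mx_scalar.
  rewrite -scalemxAl !scalerA mulVf ?gt_eqF// !scale1r mulr1.
  by rewrite /D addrC subrK.
have /IH[G DE] : posdef D.
  have := pA; rewrite AE => /(posdef_congr uP)/posdef_drsubmx.
  by rewrite block_mxKdr.
exists (P *m block_mx (Num.sqrt a)%:M 0 0 G).
rewrite trmx_mul mulmxA -(mulmxA P) {1}AE; congr (_ *m _ *m _).
rewrite tr_block_mx mulmx_block !trmx0 !mulmx0 !mul0mx !addr0 !add0r -DE.
by rewrite tr_scalar_mx -scalar_mxM -expr2 sqr_sqrtr// ltW.
Qed.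

(** [g] is the inverse of a Cholesky factor. Inside a trace, [invmx A] then splits into two factors
    that conjugate what they surround. *)
Lemma posdef_inv_ex n (A : 'M[R]_n) : posdef A ->
  exists2 g : 'M[R]_n, invmx A = g^T *m g & g *m A *m g^T = 1%:M.
Proof.
move=> pA; have [G AE] := cholesky_ex pA.
have uG : G \in unitmx.
  by have := posdef_unit pA; rewrite AE unitmx_mul => /andP[].
have uG' : G^T \in unitmx by rewrite unitmx_tr.
exists (invmx G); last by rewrite AE mulmxA mulVmx// mul1mx trmx_inv mulmxV.
have uA := posdef_unit pA; apply: (can_inj (mulmxK uA)).
by rewrite mulVmx// AE mulmxA trmx_inv mulmxKV// mulVmx.
Qed.

Lemma posdef_det_gt0 n (A : 'M[R]_n) : posdef A -> 0 < \det A.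
Proof.
move=> pA; have := posdef_unit pA; have [G ->] := cholesky_ex pA.
by rewrite unitmxE det_mulmx det_tr unitfE -expr2 exprn_even_gt0// sqrf_eq0.
Qed.

Lemma posdef_inv_sym n (A : 'M[R]_n) : posdef A -> (invmx A)^T = invmx A.
Proof. by case=> sA _; rewrite trmx_inv sA. Qed.

(* An isotropic vector of a semidefinite form lies in its kernel. *)
Lemma psd_posdef n (A : 'M[R]_n) : A^T = A ->
  (forall v : 'rV[R]_n, 0 <= (v *m A *m v^T) ord0 ord0) ->
  \det A != 0 -> posdef A.
Proof.
move=> sA A0 dA; split=> // v v0; rewrite lt0r A0 andbT.
apply: contra v0 => /eqP vAv.
suff vA0 : v *m A = 0.
  have uA : A \in unitmx by rewrite unitmxE unitfE.
  by rewrite -(mulmxK uA v) vA0 mul0mx.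
set w := v *m A.
have ww : 0 <= (w *m w^T) ord0 ord0.
  by rewrite mulmx_row_tr sumr_ge0// => i _; exact: sqr_ge0.
(* The form is nonnegative at [v + t *: w]; its constant term vanishes, so a linear and a quadratic
   term in [t] remain. *)
have key t : 0 <= t * (2 * (w *m w^T) ord0 ord0) +
                  t ^+ 2 * (w *m A *m w^T) ord0 ord0.
  have := A0 (v + t *: w); congr (0 <= _).
  have wAv : w *m A *m v^T = w *m w^T by rewrite /w trmx_mul sA !mulmxA.
  rewrite linearD linearZ /= !mulmxDl !mulmxDr -!scalemxAl -!scalemxAr wAv.
  rewrite -/w; move: (w *m w^T) (w *m A *m w^T) (w *m v^T) vAv => M1 M2 M3 M30.
  by rewrite !mxE M30; ring.
have w0 : (w *m w^T) ord0 ord0 = 0.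
  have qw := A0 w; set q := (w *m A *m w^T) _ _ in key qw.
  set s := (w *m w^T) _ _ in key ww *.
  (* At this [t] the linear term wins unless [s = 0]; dividing by [q + 1] instead of [q] covers the
     case [q = 0]. *)
  have := key (- s / (q + 1)); have q1 : 0 < q + 1 by lra.
  have -> : - s / (q + 1) * (2 * s) + (- s / (q + 1)) ^+ 2 * q =
    - (s ^+ 2 * (q + 2) / (q + 1) ^+ 2) by field; rewrite gt_eqF.
  rewrite oppr_ge0 pmulr_lle0 ?invr_gt0 ?exprn_gt0// pmulr_lle0; last by lra.
  move=> s0; apply/eqP; rewrite -sqrf_eq0.
  by apply/eqP; apply: le_anti; rewrite s0 sqr_ge0.
apply/rowP => j; rewrite [RHS]mxE; apply/eqP.
move: w0; rewrite mulmx_row_tr => /eqP.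
rewrite psumr_eq0 => [/allP/(_ j (mem_index_enum _))|i _]; last exact: sqr_ge0.
by rewrite /= sqrf_eq0.
Qed.

End PositiveDefinite.

(** * Directional derivatives and smoothness *)

Section DirectionalDerivatives.
Context {R : realType} {V : normedModType R}.
Implicit Types (x h : V) (f g : V -> R).

Lemma derive_line f x h : 'D_h f x = 'D_1 (fun t : R => f (t *: h + x)) 0.
Proof.
rewrite /derive; set g1 := fun t => t^-1 *: _; set g2 := fun t => t^-1 *: _.
suff -> : g1 = g2 by [].
by apply/funext => t; rewrite /g1 /g2 /= addr0 scale0r add0r [_%:A]mulr1.
Qed.

(** Carries one-variable rules, such as the chain rule for [ln], over to directional derivatives. *)
Lemma is_derive_line f x h d :
  is_derive x h f d <-> is_derive (0 : R) 1 (fun t : R => f (t *: h + x)) d.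
Proof.
split=> -[df dE]; split.
- exact: (derivable1P _ _ _).1 df.
- by rewrite -derive_line.
- exact: (derivable1P _ _ _).2 df.
- by rewrite derive_line.
Qed.

Lemma is_derive_mul f g x h df dg :
  is_derive x h f df -> is_derive x h g dg ->
  is_derive x h (fun z => f z * g z) (df * g x + f x * dg).
Proof.
move=> hf hg; have := @is_deriveM _ _ f g x h df dg hf hg.
by rewrite [_ *: df]mulrC addrC.
Qed.

Lemma is_derive_inv f x h d : f x != 0 ->
  is_derive x h f d -> is_derive x h (fun z => (f z)^-1) (- ((f x)^-1 * (f x)^-1 * d)).
Proof.
move=> f0 [df <-]; split; first exact: derivableV.
by rewrite deriveV// [_ *: _]mulNr expr2 invfM.
Qed.

Lemma is_derive_ln f x h d : 0 < f x ->
  is_derive x h f d -> is_derive x h (fun z => ln (f z)) ((f x)^-1 * d).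
Proof.
move=> f0 /is_derive_line df; apply/is_derive_line.
apply: is_derive1_comp; rewrite /= scale0r add0r.
exact: is_derive1_ln.
Qed.

(** For nonzero [t] the difference quotient equals [f h] exactly. *)
Lemma is_derive_linear f x h : (forall t y z, f (t *: y + z) = t * f y + f z) ->
  is_derive x h f (f h).
Proof.
move=> fl; have cf : \forall t \near (0 : R)^',
    t^-1 *: ((f \o shift x) (t *: h) - f x) = f h.
  near=> t; rewrite /= fl addrK [_ *: _]mulKf//.
  by near: t; exact: nbhs_dnbhs_neq.
have fh : (fun t => t^-1 *: ((f \o shift x) (t *: h) - f x)) @ (0 : R)^' --> f h.
  exact: cvg_near_cst.
by split; [apply/cvg_ex; exists (f h)|exact: cvg_lim].
Unshelve. all: by end_near. Qed.

Lemma is_derive_bigsum (I : Type) (r : seq I) (P : pred I) (F : I -> V -> R) dF x h :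
  (forall i, P i -> is_derive x h (F i) (dF i)) ->
  is_derive x h (fun z => \sum_(i <- r | P i) F i z) (\sum_(i <- r | P i) dF i).
Proof.
move=> dFi; elim: r => [|i r IH].
  have -> : (fun z => \sum_(i <- [::] | P i) F i z) = cst 0.
    by apply/funext => z; rewrite big_nil.
  by rewrite big_nil; exact: is_derive_cst.
rewrite big_cons; under eq_fun do rewrite big_cons.
case: ifP => // /dFi di; exact: (is_deriveD di IH).
Qed.

(** Leibniz rule; the [if] form of the summands matches the determinant of a matrix with one row
    replaced. *)
Lemma is_derive_bigprod (I : finType) (F : I -> V -> R) dF x h :
  (forall i, is_derive x h (F i) (dF i)) ->
  is_derive x h (fun z => \prod_i F i z)
    (\sum_k \prod_i (if i == k then dF i else F i x)).
Proof.
move=> dFi; rewrite (eq_bigr (fun k => dF k * \prod_(i | i != k) F i x)); last first.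
  move=> k _; rewrite (bigD1 k)//= eqxx; congr (_ * _).
  by apply: eq_bigr => i /negPf ->.
(* Induction on a duplicate-free enumeration: the new index [a] is absent from the tail, so its
   factor is differentiated only once. *)
have := index_enum_uniq I; elim: (index_enum I) => [_|a s IH /= /andP[aNs us]].
  have -> : (fun z => \prod_(i <- [::]) F i z) = cst 1.
    by apply/funext => z; rewrite big_nil.
  by rewrite big_nil; exact: is_derive_cst.
under eq_fun do rewrite big_cons.
rewrite big_cons big_cons eqxx /=.
have := is_derive_mul (dFi a) (IH us); congr (is_derive _ _ _ (_ + _)).
  congr (_ * _); rewrite [LHS]big_seq [RHS]big_seq_cond; apply: eq_bigl => i.
  by case: eqP => [->|]; rewrite ?(negPf aNs) ?andbT.
rewrite mulr_sumr [LHS]big_seq [RHS]big_seq; apply: eq_bigr => k ks.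
by rewrite big_cons ifT; [exact: mulrCA|apply: contraNneq aNs => ->].
Qed.

Lemma is_derive_mxP m n (A : V -> 'M[R]_(m, n)) x h A' :
  is_derive x h A A' <-> forall i j, is_derive x h (fun z => A z i j) (A' i j).
Proof.
split=> [[dA dE] i j|dA].
  split; first by move/derivable_mxP : dA.
  by rewrite -dE derive_mx// mxE.
have dA' : derivable A x h by apply/derivable_mxP => i j; case: (dA i j).
split=> //; rewrite derive_mx//; apply/matrixP => i j.
by rewrite mxE; case: (dA i j).
Qed.

Lemma is_derive_mulmx m n p (A : V -> 'M[R]_(m, n)) (B : V -> 'M[R]_(n, p))
    x h A' B' :
  is_derive x h A A' -> is_derive x h B B' ->
  is_derive x h (fun z => A z *m B z) (A' *m B x + A x *m B').
Proof.
move=> /is_derive_mxP dA /is_derive_mxP dB; apply/is_derive_mxP => i j.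
under eq_fun do rewrite mxE.
rewrite !mxE -big_split; apply: is_derive_bigsum => k _.
exact: is_derive_mul.
Qed.

Lemma is_derive_trmx m n (A : V -> 'M[R]_(m, n)) x h A' :
  is_derive x h A A' -> is_derive x h (fun z => (A z)^T) A'^T.
Proof.
move=> /is_derive_mxP dA; apply/is_derive_mxP => i j.
by under eq_fun do rewrite mxE; rewrite mxE.
Qed.

Lemma is_derive_mxtrace n (A : V -> 'M[R]_n) x h A' :
  is_derive x h A A' -> is_derive x h (fun z => \tr (A z)) (\tr A').
Proof. by move=> /is_derive_mxP dA; exact: is_derive_bigsum. Qed.

Lemma is_derive_summx m n (I : Type) (r : seq I) (F : I -> V -> 'M[R]_(m, n)) dF x h :
  (forall i, is_derive x h (F i) (dF i)) ->
  is_derive x h (fun z => \sum_(i <- r) F i z) (\sum_(i <- r) dF i).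
Proof.
move=> dFi; apply/is_derive_mxP => i j; under eq_fun do rewrite summxE.
rewrite summxE; apply: is_derive_bigsum => k _.
by have /is_derive_mxP := dFi k.
Qed.

(* The derivative of the determinant replaces one row at a time; expanding
   along that row produces the adjugate. *)
Lemma is_derive_det n (A : V -> 'M[R]_n) x h A' : is_derive x h A A' ->
  is_derive x h (fun z => \det (A z)) (\tr (\adj (A x) *m A')).
Proof.
move=> /is_derive_mxP dA.
pose Ak k := \matrix_(i, j) (if i == k then A' i j else A x i j).
have -> : \tr (\adj (A x) *m A') = \sum_k \det (Ak k).
  rewrite mxtrace_mulC; apply: eq_bigr => k _; rewrite mxE.
  rewrite (expand_det_row _ k); apply: eq_bigr => j _; rewrite !mxE eqxx.
  congr (_ * (_ * \det _)); apply/matrixP => a b; rewrite !mxE.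
  by rewrite eq_sym (negPf (neq_lift _ _)).
rewrite /determinant exchange_big /=; apply: is_derive_bigsum => s _.
rewrite -mulr_sumr.
have dp : is_derive x h (fun z => \prod_i A z i (s i))
    (\sum_k \prod_i (if i == k then A' i (s i) else A x i (s i))).
  exact: is_derive_bigprod.
apply: is_derive_eq (is_derive_mul (is_derive_cst ((-1) ^+ s : R) x h) dp) _.
rewrite mul0r add0r; congr (_ * _).
by apply: eq_bigr => k _; apply: eq_bigr => i _; rewrite mxE.
Qed.

End DirectionalDerivatives.

(** * Calculus of iterated directional derivatives on a set *)

Section Smooth.
Context {R : realType} {V : normedModType R} (D E : set V).
Implicit Types (x h : V) (f g : V -> R).

(* Only directions in [E] count: with [E := set0], [smooth 0] is continuity on
   [D] and the hypothesis [D_line] is void. *)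
Fixpoint smooth (n : nat) f : Prop :=
  {within D, continuous f} /\
  if n is n'.+1 then
    forall h, E h -> (forall x, D x -> derivable f x h) /\ smooth n' ('D_h f)
  else True.

Hypothesis D_line : forall x h, D x -> E h -> \forall t \near (0 : R), D (t *: h + x).

(** By [D_line] the line through [x] stays in [D] for small [t], so the two difference quotients
    eventually agree. *)
Lemma is_derive_eq_on (W : normedModType R) (f g : V -> W) x h d : D x -> E h ->
  (forall y, D y -> f y = g y) -> is_derive x h f d -> is_derive x h g d.
Proof.
move=> Dx Eh fg [/cvg_ex[l fl] <-]; rewrite /derive (cvg_lim _ fl)//.
have gl : (fun t => t^-1 *: ((g \o shift x) (t *: h) - g x)) @ (0 : R)^' --> l.
  apply: cvg_trans fl; apply: near_eq_cvg; apply: cvg_within.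
  apply: filterS (D_line Dx Eh) => t Dt /=.
  by rewrite (fg x Dx) (fg _ Dt).
by split; [apply/cvg_ex; exists l|exact: cvg_lim].
Qed.

Lemma smooth_continuous n f : smooth n f -> {within D, continuous f}.
Proof. by case: n => [|n] []. Qed.

Lemma smooth_is_derive n f x h : smooth n.+1 f -> D x -> E h ->
  is_derive x h f ('D_h f x).
Proof. by case=> _ + Dx Eh => /(_ h Eh)[/(_ x Dx) df _]; exact: derivableP. Qed.

Lemma smooth_eq n f g : (forall y, D y -> f y = g y) -> smooth n f -> smooth n g.
Proof.
elim: n f g => [|n IH] f g fg [cf df]; (split; first by
  apply: subspace_eq_continuous cf => y; rewrite inE => /fg).
  by [].
move=> h Eh; have [dfh sf] := df h Eh.
have dg x : D x -> is_derive x h g ('D_h f x).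
  by move=> Dx; apply: is_derive_eq_on fg _ => //; exact/derivableP/dfh.
split=> [x /dg[]//|]; apply: IH sf => x /dg dgx.
by rewrite derive_val.
Qed.

(** The way the closure rules below gain an order: a derivative formula valid on [D] may stand for
    ['D_h f]. *)
Lemma smoothS n f (df : V -> V -> R) : {within D, continuous f} ->
  (forall h x, E h -> D x -> is_derive x h f (df h x)) ->
  (forall h, E h -> smooth n (df h)) -> smooth n.+1 f.
Proof.
move=> cf fdf sdf; split=> // h Eh; split=> [x Dx|]; first by case: (fdf h x Eh Dx).
apply: smooth_eq (sdf h Eh) => x Dx.
by have dfx := fdf h x Eh Dx; rewrite derive_val.
Qed.

Lemma smoothW n f : smooth n.+1 f -> smooth n f.
Proof.
elim: n f => [|n IH] f [cf df]; split=> // h Eh.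
by have [dfh sf] := df h Eh; split=> //; exact: IH.
Qed.

Lemma smooth_cst n c : smooth n (fun=> c).
Proof.
elim: n c => [|n IH] c; first by split=> //; exact/continuous_subspaceT/cst_continuous.
apply: (@smoothS _ _ (fun _ _ => 0)) => [|h _].
- exact/continuous_subspaceT/cst_continuous.
- exact: IH.
Qed.

Lemma smoothD n f g : smooth n f -> smooth n g -> smooth n (fun z => f z + g z).
Proof.
elim: n f g => [|n IH] f g sf sg.
  split=> //; apply/subspace_continuousP => x Dx.
  by apply: cvgD; [move: sf|move: sg] => /smooth_continuous/subspace_continuousP; exact.
apply: (@smoothS _ _ (fun h x => 'D_h f x + 'D_h g x)) => [|h x Eh Dx|h Eh].
- apply/subspace_continuousP => x Dx.
  by apply: cvgD; [move: sf|move: sg] => /smooth_continuous/subspace_continuousP; exact.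
- exact: (is_deriveD (smooth_is_derive sf Dx Eh) (smooth_is_derive sg Dx Eh)).
- by apply: IH; [case: sf|case: sg] => _ /(_ h Eh)[].
Qed.

Lemma smoothM n f g : smooth n f -> smooth n g -> smooth n (fun z => f z * g z).
Proof.
elim: n f g => [|n IH] f g sf sg.
  split=> //; apply/subspace_continuousP => x Dx.
  by apply: cvgM; [move: sf|move: sg] => /smooth_continuous/subspace_continuousP; exact.
apply: (@smoothS _ _ (fun h x => 'D_h f x * g x + f x * 'D_h g x)) => [|h x Eh Dx|h Eh].
- apply/subspace_continuousP => x Dx.
  by apply: cvgM; [move: sf|move: sg] => /smooth_continuous/subspace_continuousP; exact.
- exact: (is_derive_mul (smooth_is_derive sf Dx Eh) (smooth_is_derive sg Dx Eh)).
- apply: smoothD; apply: IH; try exact: smoothW.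
  + by case: sf => _ /(_ h Eh)[].
  + by case: sg => _ /(_ h Eh)[].
Qed.

Lemma smoothN n f : smooth n f -> smooth n (fun z => - f z).
Proof.
move=> sf; apply: (@smooth_eq _ (fun z => (-1) * f z)) => [z _|]; first exact: mulN1r.
exact/smoothM/sf/smooth_cst.
Qed.

Lemma smooth_sum n (I : Type) (r : seq I) (P : pred I) (F : I -> V -> R) :
  (forall i, P i -> smooth n (F i)) -> smooth n (fun z => \sum_(i <- r | P i) F i z).
Proof.
move=> sF; elim: r => [|i r IH].
  by under eq_fun do rewrite big_nil; exact: smooth_cst.
under eq_fun do rewrite big_cons.
by case Pi : (P i) => //; have Fi := sF i Pi; exact: smoothD.
Qed.

Lemma smooth_prod n (I : Type) (r : seq I) (P : pred I) (F : I -> V -> R) :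
  (forall i, P i -> smooth n (F i)) -> smooth n (fun z => \prod_(i <- r | P i) F i z).
Proof.
move=> sF; elim: r => [|i r IH].
  by under eq_fun do rewrite big_nil; exact: smooth_cst.
under eq_fun do rewrite big_cons.
by case Pi : (P i) => //; have Fi := sF i Pi; exact: smoothM.
Qed.

(** Induction on the order works because the derivative is a product of [f^-1], itself one order
    lower, and ['D_h f]. *)
Lemma smoothV n f : (forall x, D x -> f x != 0) ->
  smooth n f -> smooth n (fun z => (f z)^-1).
Proof.
move=> f0; elim: n => [|n IH] sf.
  split=> //; apply/subspace_continuousP => x Dx; apply: cvgV; first exact: f0.
  by move: sf => /smooth_continuous/subspace_continuousP; exact.
apply: (@smoothS _ _ (fun h x => - ((f x)^-1 * (f x)^-1 * 'D_h f x)))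
  => [|h x Eh Dx|h Eh].
- apply/subspace_continuousP => x Dx; apply: cvgV; first exact: f0.
  by move: sf => /smooth_continuous/subspace_continuousP; exact.
- exact: (is_derive_inv (f0 x Dx) (smooth_is_derive sf Dx Eh)).
- have sfV := IH (smoothW sf); apply: smoothN; apply: smoothM; first exact: smoothM.
  by case: sf => _ /(_ h Eh)[].
Qed.

Lemma smooth_ln n f : (forall x, D x -> 0 < f x) ->
  smooth n f -> smooth n (fun z => ln (f z)).
Proof.
move=> f0 sf.
have cln : {within D, continuous (fun z => ln (f z))}.
  apply/subspace_continuousP => x Dx; apply: continuous_cvg.
    exact/continuous_ln/f0.
  by move: sf => /smooth_continuous/subspace_continuousP; exact.
case: n sf => [|n] sf; first by split.
apply: (@smoothS _ _ (fun h x => (f x)^-1 * 'D_h f x)) => [//|h x Eh Dx|h Eh].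
- exact: (is_derive_ln (f0 x Dx) (smooth_is_derive sf Dx Eh)).
- apply: smoothM; last by case: sf => _ /(_ h Eh)[].
  by apply: smoothV => [x /f0/gt_eqF/negbT//|]; exact: smoothW.
Qed.

Lemma smooth_linear n f : continuous f ->
  (forall t y z, f (t *: y + z) = t * f y + f z) -> smooth n f.
Proof.
move=> cf fl; case: n => [|n]; first by split=> //; exact: continuous_subspaceT.
apply: (@smoothS _ _ (fun h _ => f h)) => [|h x _ _|h _].
- exact: continuous_subspaceT.
- exact: is_derive_linear.
- exact: smooth_cst.
Qed.

Definition smooth_mx n p q (A : V -> 'M[R]_(p, q)) :=
  forall i j, smooth n (fun z => A z i j).

Lemma smooth_mx_is_derive n p q (A : V -> 'M[R]_(p, q)) x h :
  smooth_mx n.+1 A -> D x -> E h -> is_derive x h A ('D_h A x).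
Proof.
move=> sA Dx Eh; apply/derivableP/derivable_mxP => i j.
by case: (smooth_is_derive (sA i j) Dx Eh).
Qed.

Lemma smooth_mxD n p q (A B : V -> 'M[R]_(p, q)) :
  smooth_mx n A -> smooth_mx n B -> smooth_mx n (fun z => A z + B z).
Proof.
by move=> sA sB i j; under eq_fun do rewrite mxE; exact: smoothD.
Qed.

Lemma smooth_mxN n p q (A : V -> 'M[R]_(p, q)) :
  smooth_mx n A -> smooth_mx n (fun z => - A z).
Proof. by move=> sA i j; under eq_fun do rewrite mxE; exact: smoothN. Qed.

Lemma smooth_mx_sum n p q (I : Type) (r : seq I) (F : I -> V -> 'M[R]_(p, q)) :
  (forall i, smooth_mx n (F i)) -> smooth_mx n (fun z => \sum_(i <- r) F i z).
Proof.
move=> sF i j; under eq_fun do rewrite summxE.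
by apply: smooth_sum => k _; exact: sF.
Qed.

Lemma smooth_mxM n p q r (A : V -> 'M[R]_(p, q)) (B : V -> 'M[R]_(q, r)) :
  smooth_mx n A -> smooth_mx n B -> smooth_mx n (fun z => A z *m B z).
Proof.
move=> sA sB i j; under eq_fun do rewrite mxE.
by apply: smooth_sum => k _; exact: smoothM.
Qed.

Lemma smooth_trmx n p q (A : V -> 'M[R]_(p, q)) :
  smooth_mx n A -> smooth_mx n (fun z => (A z)^T).
Proof. by move=> sA i j; under eq_fun do rewrite mxE; exact: sA. Qed.

Lemma smooth_det n p (A : V -> 'M[R]_p) :
  smooth_mx n A -> smooth n (fun z => \det (A z)).
Proof.
move=> sA; apply: smooth_sum => s _; apply: smoothM; first exact: smooth_cst.
by apply: smooth_prod => i _; exact: sA.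
Qed.

Lemma smooth_invmx n p (A : V -> 'M[R]_p) : (forall x, D x -> A x \in unitmx) ->
  smooth_mx n A -> smooth_mx n (fun z => invmx (A z)).
Proof.
move=> uA sA i j.
(* By Cramer's rule the entries of the inverse are, on [D], polynomials in those of [A] divided by
   the determinant. *)
apply: (@smooth_eq _ (fun z => (\det (A z))^-1 * \adj (A z) i j)) => [z /uA uz|].
  by rewrite /invmx uz [RHS]mxE.
apply: smoothM.
  by apply: smoothV (smooth_det sA) => x /uA; rewrite unitmxE unitfE.
under eq_fun do rewrite mxE; apply: smoothM; first exact: smooth_cst.
by apply: smooth_det => a b; under eq_fun do rewrite !mxE; exact: sA.
Qed.

(** The inverse is differentiable by [smooth_invmx]; differentiating the identity
    [A z *m invmx (A z) = 1%:M] on [D] gives the formula. *)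
Lemma is_derive_invmx p (A : V -> 'M[R]_p) x h A' : (forall x, D x -> A x \in unitmx) ->
  smooth_mx 1 A -> D x -> E h -> is_derive x h A A' ->
  is_derive x h (fun z => invmx (A z)) (- (invmx (A x) *m A' *m invmx (A x))).
Proof.
move=> uA sA Dx Eh dA.
have dI := smooth_mx_is_derive (smooth_invmx uA sA) Dx Eh.
have dAI := is_derive_mulmx dA dI.
have d1 : is_derive x h (fun z => A z *m invmx (A z)) 0.
  apply: (@is_derive_eq_on _ (fun=> 1%:M)) (is_derive_cst _ _ _) => // y /uA uy.
  by rewrite mulmxV.
apply: is_derive_eq dI _.
have := @derive_val _ _ _ _ _ _ _ dAI; rewrite (@derive_val _ _ _ _ _ _ _ d1).
move=> /esym/eqP; rewrite addrC addr_eq0 => /eqP/(congr1 (mulmx (invmx (A x)))).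
by rewrite mulKmx ?uA// => ->; rewrite mulmxN mulmxA.
Qed.

(** Jacobi's formula: the logarithm divides the adjugate by the determinant, which leaves the
    inverse. *)
Lemma is_derive_ln_det p (A : V -> 'M[R]_p) x h A' : 0 < \det (A x) ->
  is_derive x h A A' ->
  is_derive x h (fun z => ln (\det (A z))) (\tr (invmx (A x) *m A')).
Proof.
move=> dA0 dA.
have := @is_derive_ln _ _ (fun z => \det (A z)) x h _ dA0 (is_derive_det dA).
move=> /is_derive_eq; apply.
by rewrite /invmx unitmxE unitfE gt_eqF//= -scalemxAl mxtraceZ.
Qed.

End Smooth.

(** * Topology of matrices *)

Section MatrixTopology.
Context {R : realType}.

Lemma cvg_mx (T : Type) (F : set_system T) (FF : Filter F) m n
    (A : T -> 'M[R]_(m, n)) (M : 'M[R]_(m, n)) :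
  (forall i j, A z i j @[z --> F] --> M i j) -> A @ F --> M.
Proof.
move=> cA P [Q MQ sQP]; apply: (@filterS _ _ _ [set z | forall i j, Q i j (A z i j)]).
  by move=> z Qz; exact: sQP.
apply: filter_forall => i; apply: filter_forall => j.
exact: cA (MQ i j).
Qed.

(** With an empty set of directions, the closure rules for [smooth] serve as continuity proofs. *)
Lemma smooth0_continuous_at (V : normedModType R) (D : set V) (f : V -> R) x :
  open D -> smooth D set0 0 f -> D x -> f @ x --> f x.
Proof.
move=> oD [+ _] Dx; rewrite continuous_open_subspace// => /(_ x); apply.
by rewrite inE.
Qed.


(** Normalize [A] to the identity by [g], so that [g *m B *m g^T] is the identity plus [M B]. When
    [frob (M B) < 1], the perturbation cannot cancel the squared norm of [u = v *m invmx g]. *)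
Lemma posdef_near L (A : 'M[R]_L) : posdef A ->
  \forall B \near A, B^T = B -> posdef B.
Proof.
move=> pA; have [g _ gAg] := posdef_inv_ex pA.
pose M (B : 'M[R]_L) := g *m (B - A) *m g^T.
have cM : \tr (M B *m (M B)^T) @[B --> A] --> \tr (M A *m (M A)^T).
  apply: (@smooth0_continuous_at _ setT) => //; first exact: openT.
  apply: smooth_sum => // i _.
  have sM : smooth_mx setT set0 0 M.
    apply: smooth_mxM => //; last by move=> a b; exact: smooth_cst.
    apply: smooth_mxM => //; first by move=> a b; exact: smooth_cst.
    apply: smooth_mxD => //; last by move=> a b; exact: smooth_cst.
    by move=> a b; split=> //; apply: continuous_subspaceT; exact: coord_continuous.
  by apply: (smooth_mxM _ sM (smooth_trmx sM)).
have M0 : \tr (M A *m (M A)^T) = 0 by rewrite /M subrr mulmx0 !mul0mx mxtrace0.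
rewrite M0 in cM.
have : \forall B \near A, \tr (M B *m (M B)^T) < 1.
  exact: (cvgr_lt _ cM).
apply: filterS => B MB1 sB; split=> // v v0.
have ug : g \in unitmx.
  by have := gAg; rewrite -mulmxA => /mulmx1_unit[].
have {MB1} fM : frob (M B) < 1.
  by rewrite -(ltr_pXn2r (n := 2)) ?nnegrE ?frob_ge0// expr1n sqr_frob.
set u := v *m invmx g.
have u0 : u != 0.
  by apply: contra v0 => /eqP u0; rewrite -(mulmxKV ug v) -/u u0 mul0mx.
have -> : (v *m B *m v^T) ord0 ord0 = frob u ^+ 2 + \tr (u *m M B *m u^T).
  rewrite sqr_frob -mxtraceD; have -> : u *m u^T + u *m M B *m u^T = v *m B *m v^T.
    have -> : u *m u^T = u *m (g *m A *m g^T) *m u^T by rewrite gAg mulmx1.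
    rewrite -mulmxDl -mulmxDr /M -mulmxDl -mulmxDr addrC subrK.
    by rewrite !mulmxA mulmxKV// -mulmxA -trmx_mul mulmxKV.
  by rewrite /mxtrace big_ord1.
have fu : 0 < frob u.
  rewrite lt0r frob_ge0 andbT; apply: contra u0; rewrite -sqrf_eq0 sqr_frob.
  rewrite /mxtrace big_ord1 mulmx_row_tr.
  rewrite psumr_eq0 => [/allP u0|i _]; last exact: sqr_ge0.
  apply/eqP/rowP => i; rewrite [RHS]mxE; apply/eqP.
  by have := u0 i (mem_index_enum _); rewrite /= sqrf_eq0.
have := frob_mxtrace_conj u (M B); rewrite ler_norml => /andP[+ _].
have : frob (M B) * frob u ^+ 2 < frob u ^+ 2 by rewrite gtr_pMl// exprn_gt0.
lra.
Qed.

Lemma det_le n (A : 'M[R]_n) (M : R) : (forall i j, `|A i j| <= M) ->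
  `|\det A| <= M ^+ n *+ #|{: 'S_n}|.
Proof.
move=> AM; rewrite -sumr_const; apply: le_trans (ler_norm_sum _ _ _) _.
apply: ler_sum => s _; rewrite normrM normrX normrN1 expr1n mul1r normr_prod.
rewrite -[n in M ^+ n]card_ord -prodr_const; apply: ler_prod => i _.
by rewrite normr_ge0 AM.
Qed.

(** Nonnegativity at the sum and the difference of two basis vectors bounds twice the entry;
    nonnegative diagonal entries then give the stated bound. *)
Lemma posdef_entry_le n (A : 'M[R]_n) i j : posdef A -> `|A i j| <= A i i + A j j.
Proof.
move=> pA.
have [d dE] : exists d : 'I_n -> 'rV[R]_n,
    forall a b, (d a *m A *m (d b)^T) ord0 ord0 = A a b.
  exists (fun a => delta_mx ord0 a) => a b.
  rewrite trmx_delta -rowE mxE (bigD1 b)//= !mxE !eqxx mulr1 big1 ?addr0// => k kb.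
  by rewrite !mxE (negPf kb) mulr0.
have qE s t : ((s *: d i + t *: d j) *m A *m (s *: d i + t *: d j)^T) ord0 ord0 =
    s ^+ 2 * A i i + 2 * s * t * A i j + t ^+ 2 * A j j.
  have sA : A j i = A i j by rewrite -[in LHS]pA.1 mxE.
  rewrite linearD !linearZ /= !mulmxDl !mulmxDr -!scalemxAl -!scalemxAr.
  move: (dE i i) (dE i j) (dE j i) (dE j j).
  move: (d i *m A *m (d i)^T) (d i *m A *m (d j)^T) (d j *m A *m (d i)^T)
    (d j *m A *m (d j)^T) => M1 M2 M3 M4 e1 e2 e3 e4.
  by rewrite !mxE e1 e2 e3 e4 sA; ring.
have := posdef_ge0 (1 *: d i + 1 *: d j) pA.
have := posdef_ge0 (1 *: d i + (-1) *: d j) pA.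
have := posdef_ge0 (1 *: d i + 0 *: d j) pA.
have := posdef_ge0 (0 *: d i + 1 *: d j) pA.
by rewrite !qE => h1 h2 h3 h4; rewrite ler_norml; apply/andP; split; lra.
Qed.

End MatrixTopology.

(** * Geometry of the cone *)

Section Domain.
Context {R : realType} {L n : nat}.
Local Notation V := ('M[R]_L * 'M[R]_(n * L, L))%type.
Local Notation inner := (@Kl2_inner R L n).
Local Notation E := (@Espace R L n).
Implicit Types (Z h : V) (v : 'rV[R]_L) (w : 'I_n -> 'rV[R]_L).

Lemma XiD a b Y Z i : Xi (a *: Y + b *: Z : V) i = a *: Xi Y i + b *: Xi Z i.
Proof. by apply/matrixP => j k; rewrite !mxE. Qed.

Lemma inner_sub : inner `<=` E.
Proof. by move=> Z [[]]. Qed.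

Lemma Espace_lin a b Y Z : E Y -> E Z -> E (a *: Y + b *: Z).
Proof. by move=> EY EZ; rewrite /Espace /= linearD !linearZ /= EY EZ. Qed.

Lemma schurL2_sym Z : E Z -> (schurL2 Z)^T = schurL2 Z.
Proof.
move=> EZ; rewrite /schurL2 linearB linear_sum /= EZ; congr (_ - _).
by apply: eq_bigr => i _; rewrite !trmx_mul trmxK trmx_inv EZ mulmxA.
Qed.

(* The quadratic form of [[X_1, -B], [-B^T, I (x) X_1]] with B = (X_2, ..., X_m):
   unlike the Schur complement it is linear in Z. *)
Definition block_form Z v w : R := (v *m Z.1 *m v^T) ord0 ord0 -
  \sum_i (2 * (v *m Xi Z i *m (w i)^T) ord0 ord0 - (w i *m Z.1 *m (w i)^T) ord0 ord0).

Lemma block_formD a b Y Z v w :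
  block_form (a *: Y + b *: Z) v w = a * block_form Y v w + b * block_form Z v w.
Proof.
rewrite /block_form !mulrBr !mulr_sumr addrACA -opprD -big_split /=.
congr (_ - _).
  by rewrite mulmxDr mulmxDl -!scalemxAr -!scalemxAl !mxE.
apply: eq_bigr => i _; rewrite XiD !(mulmxDr, mulmxDl) -!scalemxAr -!scalemxAl.
move: (v *m Xi Y i *m _) (v *m Xi Z i *m _) (w i *m Y.1 *m _) (w i *m Z.1 *m _).
by move=> M1 M2 M3 M4; rewrite !mxE; ring.
Qed.

(** Completing the square in each [w i]: the minimum over [w] is the form of the Schur complement,
    attained at [v *m Xi Z i *m invmx Z.1]. *)
Lemma block_form_schur Z v w : E Z -> Z.1 \in unitmx ->
  block_form Z v w = (v *m schurL2 Z *m v^T) ord0 ord0 +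
    \sum_i ((w i - v *m Xi Z i *m invmx Z.1) *m Z.1 *m
            (w i - v *m Xi Z i *m invmx Z.1)^T) ord0 ord0.
Proof.
move=> EZ uZ.
have -> : (v *m schurL2 Z *m v^T) ord0 ord0 = (v *m Z.1 *m v^T) ord0 ord0 -
    \sum_i (v *m (Xi Z i *m invmx Z.1 *m (Xi Z i)^T) *m v^T) ord0 ord0.
  rewrite /schurL2 mulmxBr mulmxBl [LHS]mxE [X in _ + X]mxE.
  by rewrite mulmx_sumr mulmx_suml summxE.
rewrite -addrA; congr (_ + _); rewrite -!sumrN -big_split /=.
apply: eq_bigr => i _; set u := v *m Xi Z i *m invmx Z.1.
have uX : u *m Z.1 = v *m Xi Z i by rewrite /u mulmxKV.
have uXu : u *m Z.1 *m u^T = v *m (Xi Z i *m invmx Z.1 *m (Xi Z i)^T) *m v^T.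
  by rewrite uX /u !trmx_mul trmx_inv EZ !mulmxA.
move: u uX uXu => u uX uXu.
have wXu : (w i *m Z.1 *m u^T) ord0 ord0 = (u *m Z.1 *m (w i)^T) ord0 ord0.
  transitivity ((w i *m Z.1 *m u^T)^T ord0 ord0); first by rewrite [RHS]mxE.
  by rewrite !trmx_mul trmxK EZ mulmxA.
rewrite -uXu -uX [(w i - u)^T]linearB /= !mulmxBl !mulmxBr; move: wXu.
move: (u *m Z.1 *m (w i)^T) (w i *m Z.1 *m u^T).
move: (w i *m Z.1 *m (w i)^T) (u *m Z.1 *m u^T).
by move=> M1 M2 M3 M4 M43; rewrite !mxE M43; ring.
Qed.

(** Replaces the nonlinear condition on the Schur complement by conditions linear in [Z]; the
    converse tests [block_form] at its minimizer in [w]. *)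
Lemma Kl2_innerP Z :
  inner Z <-> posdef Z.1 /\ forall v w, v != 0 -> 0 < block_form Z v w.
Proof.
split=> [[pX pS]|[pX qZ]]; split=> //.
  move=> v w v0; rewrite block_form_schur; [|exact: pX.1|exact: posdef_unit].
  rewrite ltr_pwDl ?pS.2// sumr_ge0// => i _; exact: posdef_ge0.
have EZ : E Z by exact: pX.1.
split=> [|v v0]; first exact: schurL2_sym.
have := qZ v (fun i => v *m Xi Z i *m invmx Z.1) v0.
rewrite block_form_schur//; last exact: posdef_unit.
by rewrite big1 ?addr0// => i _; rewrite subrr !mul0mx mxE.
Qed.

(** The conditions of [Kl2_innerP] are linear and strict. One coefficient may vanish, so that
    segments are covered up to their endpoints. *)
Lemma inner_cone a b Y Z : 0 <= a -> 0 <= b -> 0 < a + b ->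
  inner Y -> inner Z -> inner (a *: Y + b *: Z).
Proof.
move=> a0 b0 ab0 /Kl2_innerP[pY qY] /Kl2_innerP[pZ qZ]; apply/Kl2_innerP.
have comb (s t : R) : 0 < s -> 0 < t -> 0 < a * s + b * t.
  move=> s0 t0; have [az|an0] := eqVneq a 0.
    by rewrite az mul0r add0r mulr_gt0//; lra.
  have ap : 0 < a by rewrite lt0r an0.
  by apply: ltr_pwDl; [exact: mulr_gt0|apply: mulr_ge0 => //; exact: ltW].
split=> [|v w v0]; last by rewrite block_formD; apply: comb; [exact: qY|exact: qZ].
split=> [|v v0]; first exact: (Espace_lin _ _ pY.1 pZ.1).
have := comb _ _ (pY.2 v v0) (pZ.2 v v0); congr (0 < _).
by rewrite mulmxDr mulmxDl -!scalemxAr -!scalemxAl !mxE.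
Qed.

Lemma fst_entry_continuous i j : continuous (fun Z : V => Z.1 i j).
Proof.
move=> Z; apply: (@continuous_cvg _ _ _ _ _ fst (fun M : 'M[R]_L => M i j)).
  exact: coord_continuous.
exact: cvg_fst.
Qed.

Lemma snd_entry_continuous i j : continuous (fun Z : V => Z.2 i j).
Proof.
move=> Z; apply: (@continuous_cvg _ _ _ _ _ snd (fun M : 'M[R]_(n * L, L) => M i j)).
  exact: coord_continuous.
exact: cvg_snd.
Qed.

Section SmoothSchur.
Context (D F : set V) (k : nat).
Hypothesis D_line : forall x h, D x -> F h -> \forall t \near (0 : R), D (t *: h + x).

Lemma smooth_fst : smooth_mx D F k (fun Z => Z.1).
Proof.
move=> i j; apply: smooth_linear => // [|t y z]; last by rewrite !mxE.
exact: fst_entry_continuous.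
Qed.

Lemma smooth_Xi i : smooth_mx D F k (fun Z => Xi Z i).
Proof.
move=> a b; under eq_fun do rewrite mxE.
apply: smooth_linear => // [|t y z]; last by rewrite !mxE.
exact: snd_entry_continuous.
Qed.

(** With [F := set0] this yields continuity, with [F := E] the derivatives of the barrier. *)
Lemma smooth_schurL2 : (forall Z, D Z -> Z.1 \in unitmx) ->
  smooth_mx D F k (fun Z => schurL2 Z).
Proof.
move=> uD; apply: smooth_mxD => //; first exact: smooth_fst.
apply: smooth_mxN => //; apply: smooth_mx_sum => // i.
apply: smooth_mxM => //; last exact/smooth_trmx/smooth_Xi.
by apply: smooth_mxM => //; [exact: smooth_Xi|exact/smooth_invmx/smooth_fst].
Qed.

End SmoothSchur.

Lemma det_fst_continuous : continuous (fun Z : V => \det Z.1).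
Proof.
move=> Z; apply: (@smooth0_continuous_at _ _ setT) => //; first exact: openT.
by apply: smooth_det => //; exact: smooth_fst.
Qed.

Lemma schurL2_cvg Z : \det Z.1 != 0 -> schurL2 Y @[Y --> Z] --> schurL2 Z.
Proof.
move=> Z0; apply: cvg_mx => i j.
apply: (@smooth0_continuous_at _ _ [set Y : V | \det Y.1 != 0]) => //.
  have := open_comp (fun Z _ => @det_fst_continuous Z) (@open_neq R 0); exact.
by apply: smooth_schurL2 => // Y; rewrite unitmxE unitfE.
Qed.

Lemma inner_near Z : inner Z -> \forall Y \near Z, E Y -> inner Y.
Proof.
move=> [pX pS]; have dX : \det Z.1 != 0 by rewrite gt_eqF// posdef_det_gt0.
have cX : (Y.1 : 'M[R]_L) @[Y --> Z] --> Z.1 by exact: cvg_fst.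
have nX : \forall Y \near Z, Y.1^T = Y.1 -> posdef Y.1 := cX _ (posdef_near pX).
have nS : \forall Y \near Z, (schurL2 Y)^T = schurL2 Y -> posdef (schurL2 Y).
  exact: schurL2_cvg dX _ (posdef_near pS).
apply: filterS2 nX nS => Y pXY pSY EY.
by split; [exact: pXY|apply: pSY; exact: schurL2_sym].
Qed.

(** Provides [D_line] for the cone with directions in [E]. *)
Lemma inner_line Z h : inner Z -> E h -> \forall t \near (0 : R), inner (t *: h + Z).
Proof.
move=> iZ Eh.
have cl : (t *: h + Z) @[t --> (0 : R)] --> Z.
  rewrite -[X in _ --> X]add0r; apply: cvgD; last exact: cvg_cst.
  by rewrite -[X in _ --> X](scale0r h); apply: cvgZr_tmp; exact: cvg_id.
have nZ : \forall t \near (0 : R), E (t *: h + Z) -> inner (t *: h + Z).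
  exact: cl _ (inner_near iZ).
apply: filterS nZ => t; apply.
by rewrite -[Z]scale1r; apply: Espace_lin => //; exact: inner_sub.
Qed.

Lemma Espace_closed : closed E.
Proof.
have -> : E = \bigcap_(ij in [set: 'I_L * 'I_L])
    [set Z : V | Z.1 ij.1 ij.2 - Z.1 ij.2 ij.1 = 0].
  apply/seteqP; split=> [Z EZ [i j] _ /=|Z EZ].
    by rewrite -[in X in X - _]EZ mxE subrr.
  apply/matrixP => i j; rewrite mxE; apply/eqP; rewrite -subr_eq0.
  by apply/eqP; exact: (EZ (j, i)).
apply: closed_bigI => -[i j] _ /=.
apply: (@preimage_closed _ _ (fun Z : V => Z.1 i j - Z.1 j i) [set x | x = 0]).
  by move=> Z _; apply: cvgB; exact: fst_entry_continuous.
exact: closed_eq.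
Qed.

Lemma Kl2_sub : @Kl2 R L n `<=` E.
Proof.
rewrite [X in _ `<=` X](closure_id _).1; last exact: Espace_closed.
by apply: closureS; exact: inner_sub.
Qed.

Lemma inner_nonempty : inner (1%:M, 0).
Proof.
have p1 : posdef (1%:M : 'M[R]_L).
  split=> [|v v0]; first exact: trmx1.
  rewrite mulmx1 mulmx_row_tr lt0r sumr_ge0 ?andbT; last by move=> i _; exact: sqr_ge0.
  apply: contra v0; rewrite psumr_eq0 => [/allP v0|i _]; last exact: sqr_ge0.
  apply/eqP/rowP => i; rewrite [RHS]mxE; apply/eqP.
  by have := v0 i (mem_index_enum _); rewrite /= sqrf_eq0.
split=> //; rewrite /schurL2 big1 ?subr0// => i _.
have -> : Xi (1%:M, 0) i = 0 :> 'M[R]_L by apply/matrixP => a b; rewrite !mxE.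
by rewrite !mul0mx.
Qed.

(* Let [I = (1%:M, 0)]. If [Z] is interior then [Y := Z + c (Z - I)] is still in
   the closure for small [c]; when [U] in the cone is close to [Y], [Z] is a
   positive combination of [U] and of a point close to [I]. *)
Lemma relint_Kl2 : relint E (@Kl2 R L n) = inner.
Proof.
apply/seteqP; split=> [Z [KZ [e e0 eZ]]|Z iZ]; last first.
  split; first exact: subset_closure.
  have /nbhs_ballP[e e0 eZ] := inner_near iZ; exists e => // Y EY ZY.
  by apply: subset_closure; exact: eZ.
set I : V := (1%:M, 0); have iI : inner I := inner_nonempty.
have EZ : E Z := Kl2_sub KZ; have EI : E I := inner_sub iI.
have [c c0 KY] : exists2 c : R, 0 < c & @Kl2 R L n ((1 + c) *: Z + (- c) *: I).
  have cl : ((1 + c) *: Z + (- c) *: I) @[c --> (0 : R)] --> Z.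
    rewrite -[X in _ --> X]addr0; apply: cvgD.
      rewrite -[X in _ --> X]scale1r; apply: cvgZr_tmp.
      by rewrite -[X in _ --> X]addr0; apply: cvgD; [exact: cvg_cst|exact: cvg_id].
    rewrite -[X in _ --> X](scale0r I); apply: cvgZr_tmp.
    by rewrite -[X in _ --> X]oppr0; apply: cvgN; exact: cvg_id.
  have /nbhs_ballP[d d0 dZ] := cl _ (nbhsx_ballx Z e e0).
  exists (d / 2); first by rewrite divr_gt0.
  apply: eZ; first exact: Espace_lin.
  apply: dZ; rewrite /ball /= sub0r normrN gtr0_norm ?divr_gt0//.
  by rewrite ltr_pdivrMr// ltr_pMr// ltr1n.
set Y := _ + _ in KY.
(* This map of [U] sends [Y] to [I], so by continuity a [U] close to [Y] lands in the cone; solving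
   for [Z] gives the combination below. *)
have cl : (c^-1 *: ((1 + c) *: Z - U)) @[U --> Y] --> I.
  have -> : I = c^-1 *: ((1 + c) *: Z - Y).
    by rewrite /Y opprD addrA subrr add0r scaleNr opprK scalerA mulVf ?gt_eqF// scale1r.
  apply: cvgZl_tmp; apply: cvgB; [exact: cvg_cst|exact: cvg_id].
have [U [iU nU]] := KY _ (cl _ (inner_near iI)).
have iW := nU _; set W := c^-1 *: _ in iW.
have {}iW : inner W.
  apply: iW; rewrite /W scalerBr scalerA -scaleNr.
  exact: (Espace_lin _ _ EZ (inner_sub iU)).
have -> : Z = (1 + c)^-1 *: U + ((1 + c)^-1 * c) *: W.
  rewrite /W scalerA mulfK ?gt_eqF// -scalerDr [U + _]addrC subrK scalerA.
  by rewrite mulVf ?scale1r// gt_eqF//; lra.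
have c1 : 0 < (1 + c)^-1 by rewrite invr_gt0; lra.
apply: inner_cone => //; [exact: ltW|exact/ltW/mulr_gt0|].
by rewrite ltr_pwDl ?ltW ?mulr_gt0.
Qed.

End Domain.

(** * Blow-up of the barrier at the boundary *)

Section BarrierLimit.
Context {R : realType} {L n : nat}.
Local Notation V := ('M[R]_L * 'M[R]_(n * L, L))%type.
Local Notation inner := (@Kl2_inner R L n).
Local Notation E := (@Espace R L n).

Lemma det_continuous m : continuous (fun A : 'M[R]_m => \det A).
Proof.
move=> A; apply: (@smooth0_continuous_at _ _ setT) => //; first exact: openT.
by apply: smooth_det => // i j; apply: smooth_linear => // [|t y z];
  [exact: coord_continuous|rewrite !mxE].
Qed.

Lemma qform_continuous m (v : 'rV[R]_m) :
  continuous (fun A : 'M[R]_m => (v *m A *m v^T) ord0 ord0).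
Proof.
move=> A; apply: (@smooth0_continuous_at _ _ setT) => //; first exact: openT.
have sc p q (B : 'M[R]_(p, q)) : smooth_mx [set: 'M[R]_m] set0 0 (fun=> B).
  by move=> i j; exact: smooth_cst.
apply: (smooth_mxM _ (smooth_mxM _ (sc _ _ v) _) (sc _ _ v^T)) => // i j.
by apply: smooth_linear => // [|t y z]; [exact: coord_continuous|rewrite !mxE].
Qed.

(** Each subtracted term is a Gram matrix, whose diagonal is nonnegative. *)
Lemma schurL2_diag_le (Z : V) i : inner Z -> schurL2 Z i i <= Z.1 i i.
Proof.
move=> [pX _]; have [g gE _] := posdef_inv_ex pX.
rewrite /schurL2 !mxE summxE gerBl sumr_ge0// => k _.
rewrite gE; have -> : Xi Z k *m (g^T *m g) *m (Xi Z k)^T =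
    (Xi Z k *m g^T) *m (Xi Z k *m g^T)^T by rewrite trmx_mul trmxK !mulmxA.
by rewrite mxE sumr_ge0// => j _; rewrite [_^T _ _]mxE -expr2 sqr_ge0.
Qed.

(** Along the sequence [Fhat] equals [- ln (p k)], so it suffices that the product [p] of the two
    determinants tends to 0. *)
Lemma Fhat_barrier (u : nat -> V) (x : V) : (forall k, inner (u k)) -> E x ->
  ~ inner x -> u @ \oo --> x -> (@Fhat R L n \o u) @ \oo --> +oo.
Proof.
move=> iu Ex nx ux.
have uX : (u k).1 @[k --> \oo] --> x.1.
  by apply: (@cvg_comp _ _ _ u fst _ _ _ ux); exact: cvg_fst.
have dX : \det (u k).1 @[k --> \oo] --> \det x.1.
  apply: (@cvg_comp _ _ _ _ (fun A : 'M[R]_L => \det A) _ _ _ uX).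
  exact: det_continuous.
(* Limits of positive definite matrices are semidefinite. *)
have psd m (A : nat -> 'M[R]_m) (B : 'M[R]_m) (v : 'rV[R]_m) :
    (forall k, posdef (A k)) -> A @ \oo --> B -> 0 <= (v *m B *m v^T) ord0 ord0.
  move=> pA AB; apply: (@cvgr_to_ge _ \oo _ _ (fun k => (v *m A k *m v^T) ord0 ord0)).
    pose q (M : 'M[R]_m) := (v *m M *m v^T) ord0 ord0.
    by apply: (@cvg_comp _ _ _ _ q _ _ _ AB); exact: qform_continuous.
  by apply: nearW => k; exact: posdef_ge0.
pose p k := \det (schurL2 (u k)) * \det (u k).1.
have p_gt0 k : 0 < p k by rewrite mulr_gt0// posdef_det_gt0//; case: (iu k).
have p0 : p @ \oo --> 0.
  (* First the case of invertible [x.1]: the Schur complement is continuous at [x], and were its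
     limit invertible too, [x] would lie in the cone by [psd_posdef]. *)
  have [x0|x0] := eqVneq (\det x.1) 0; last first.
    have pX : posdef x.1.
      by apply: psd_posdef => // v; apply: psd uX => k; case: (iu k).
    have uS : schurL2 (u k) @[k --> \oo] --> schurL2 x.
      by apply: (@cvg_comp _ _ _ u (@schurL2 R L n) _ _ _ ux); exact: schurL2_cvg.
    have dS : \det (schurL2 (u k)) @[k --> \oo] --> \det (schurL2 x).
      apply: (@cvg_comp _ _ _ _ (fun A : 'M[R]_L => \det A) _ _ _ uS).
      exact: det_continuous.
    have S0 : \det (schurL2 x) = 0.
      apply/eqP/negPn/negP => S0; apply: nx; split=> //; apply: psd_posdef => //.
        exact: schurL2_sym.
      by move=> v; apply: psd uS => k; case: (iu k).
    by rewrite -[0](mul0r (\det x.1)) -S0; apply: cvgM.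
  (* Now [\det x.1 = 0]. An entry of the Schur complement is bounded by the sum of two of its
     diagonal entries, hence the doubling in [M]; the Leibniz formula then bounds its determinant by
     [C]. *)
  pose M := (1 + \sum_i `|x.1 i i|) *+ 2; pose C := M ^+ L *+ #|{: 'S_L}|.
  have Xle : \forall k \near \oo, forall i, (u k).1 i i <= 1 + \sum_i `|x.1 i i|.
    apply: filter_forall => i.
    have cXi : (u k).1 i i @[k --> \oo] --> x.1 i i.
      apply: (@cvg_comp _ _ _ _ (fun A : 'M[R]_L => A i i) _ _ _ uX).
      exact: coord_continuous.
    apply: (cvgr_le _ cXi); apply: le_lt_trans (ler_norm _) _.
    by rewrite (bigD1 i)//= addrCA ltrDl ltr_pwDl// sumr_ge0.
  apply: (@squeeze_cvgr _ _ _ _ (cst 0) (fun k => C * \det (u k).1)).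
  - apply: filterS Xle => k Xk; rewrite ltW//= ler_wpM2r//.
      by rewrite ltW// posdef_det_gt0//; case: (iu k).
    apply: le_trans (ler_norm _) (det_le _) => i j.
    apply: le_trans (posdef_entry_le _ _ (iu k).2) _; rewrite /M mulr2n.
    by apply: lerD; apply: le_trans (schurL2_diag_le _ (iu k)) (Xk _).
  - exact: cvg_cst.
  - by rewrite -[0](mulr0 C) -x0; apply: cvgM => //; exact: cvg_cst.
apply/cvgryPge => A.
have : \forall k \near \oo, p k < expR (- A) by apply: (cvgr_lt _ p0); exact: expR_gt0.
apply: filterS => k pk; have [pX pS] := iu k.
rewrite /= /Fhat -opprD -lnM ?posrE ?posdef_det_gt0// lerNr -(expRK (- A)).
by rewrite ler_ln ?posrE ?expR_gt0 ?p_gt0// ltW.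
Qed.

End BarrierLimit.

(** * Derivatives of the barrier along a line *)

Section Derivatives.
Context {R : realType} {L n : nat}.
Local Notation V := ('M[R]_L * 'M[R]_(n * L, L))%type.
Local Notation inner := (@Kl2_inner R L n).
Local Notation E := (@Espace R L n).
Implicit Types (Z h : V) (i : 'I_n).

Definition Wmx i Z := Xi Z i *m invmx Z.1.

Definition Dmx h i Z := Xi h i - Wmx i Z *m h.1.

(** The derivative S' in direction [h]; the summand with [h.1] in the middle comes from
    differentiating [invmx Z.1]. *)
Definition schur1 h Z := h.1 -
  \sum_i (Xi h i *m (Wmx i Z)^T + Wmx i Z *m (Xi h i)^T -
          Wmx i Z *m h.1 *m (Wmx i Z)^T).

Definition schur2 h Z := \sum_i (-2) *: (Dmx h i Z *m invmx Z.1 *m (Dmx h i Z)^T).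

Definition schur3 h Z :=
  \sum_i 6 *: (Dmx h i Z *m (invmx Z.1 *m h.1 *m invmx Z.1) *m (Dmx h i Z)^T).

Lemma is_derive_fst Z h : is_derive Z h (fun Y : V => Y.1) h.1.
Proof.
apply/is_derive_mxP => i j.
by apply: (@is_derive_linear _ _ (fun Y : V => Y.1 i j)) => t y z; rewrite !mxE.
Qed.

Lemma is_derive_Xi Z h i : is_derive Z h (fun Y : V => Xi Y i) (Xi h i).
Proof.
apply/is_derive_mxP => a b.
by apply: (@is_derive_linear _ _ (fun Y : V => Xi Y i a b)) => t y z; rewrite !mxE.
Qed.

Section AtPoint.
Context (Z h : V).
Hypotheses (iZ : inner Z) (Eh : E h).

Lemma inner_unit Y : inner Y -> Y.1 \in unitmx.
Proof. by case=> /posdef_unit. Qed.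

Lemma is_derive_invX :
  is_derive Z h (fun Y : V => invmx Y.1) (- (invmx Z.1 *m h.1 *m invmx Z.1)).
Proof.
apply: (is_derive_invmx (@inner_line R L n) inner_unit) (is_derive_fst Z h) => //.
exact: (smooth_fst _ (@inner_line R L n)).
Qed.

Lemma is_derive_Wmx i : is_derive Z h (Wmx i) (Dmx h i Z *m invmx Z.1).
Proof.
apply: is_derive_eq (is_derive_mulmx (is_derive_Xi Z h i) is_derive_invX) _.
by rewrite mulmxN /Dmx /Wmx mulmxBl !mulmxA.
Qed.

(** Since W' is [D *m invmx Z.1] and D' is - W' H_1, differentiation introduces no new matrices. *)
Lemma is_derive_Dmx i : is_derive Z h (Dmx h i) (- (Dmx h i Z *m invmx Z.1 *m h.1)).
Proof.
have dW := is_derive_mulmx (is_derive_Wmx i) (is_derive_cst h.1 Z h).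
apply: is_derive_eq (is_deriveB (is_derive_cst (Xi h i) Z h) dW) _.
by rewrite mulmx0 addr0 sub0r.
Qed.

Lemma is_derive_schur : is_derive Z h (@schurL2 R L n) (schur1 h Z).
Proof.
pose dS i := is_derive_mulmx (is_derive_mulmx (is_derive_Xi Z h i) is_derive_invX)
  (is_derive_trmx (is_derive_Xi Z h i)).
apply: is_derive_eq (is_deriveB (is_derive_fst Z h) (is_derive_summx _ dS)) _.
rewrite /schur1; congr (_ - _); apply: eq_bigr => i _.
have WT : (Wmx i Z)^T = invmx Z.1 *m (Xi Z i)^T.
  by rewrite trmx_mul (posdef_inv_sym iZ.1).
by rewrite WT /Wmx mulmxN mulmxBl !mulmxA addrAC.
Qed.

Lemma is_derive_schur1 : is_derive Z h (schur1 h) (schur2 h Z).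
Proof.
pose dS i := is_deriveB (is_deriveD
  (is_derive_mulmx (is_derive_cst (Xi h i) Z h) (is_derive_trmx (is_derive_Wmx i)))
  (is_derive_mulmx (is_derive_Wmx i) (is_derive_cst (Xi h i)^T Z h)))
  (is_derive_mulmx (is_derive_mulmx (is_derive_Wmx i) (is_derive_cst h.1 Z h))
     (is_derive_trmx (is_derive_Wmx i))).
apply: is_derive_eq (is_deriveB (is_derive_cst h.1 Z h) (is_derive_summx _ dS)) _.
rewrite sub0r -sumrN; apply: eq_bigr => i _.
rewrite !mul0mx !mulmx0 add0r !addr0.
set W := Wmx i Z; set D := Dmx h i Z.
have -> : (D *m invmx Z.1)^T = invmx Z.1 *m D^T.
  by rewrite trmx_mul (posdef_inv_sym iZ.1).
have DT : D^T = (Xi h i)^T - h.1 *m W^T.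
  by rewrite /D /Dmx linearB /= trmx_mul Eh.
have DE : D = Xi h i - W *m h.1 by [].
move: D W DT DE => D W DT DE.
(* Regrouping makes [D] and [D^T] appear as factors, which leaves two copies of
   [D *m invmx Z.1 *m D^T]. *)
have -> : Xi h i *m (invmx Z.1 *m D^T) + D *m invmx Z.1 *m (Xi h i)^T -
    (D *m invmx Z.1 *m h.1 *m W^T + W *m h.1 *m (invmx Z.1 *m D^T)) =
    (Xi h i - W *m h.1) *m (invmx Z.1 *m D^T) +
    D *m invmx Z.1 *m ((Xi h i)^T - h.1 *m W^T).
  by rewrite mulmxBl mulmxBr !mulmxA [RHS]addrACA -opprD [X in _ - X]addrC.
by rewrite -DT -DE mulmxA -mulr2n -scaler_nat scaleNr.
Qed.

(** The three terms of the product rule coincide, each with a minus sign, so -2 becomes 6. *)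
Lemma is_derive_schur2 : is_derive Z h (schur2 h) (schur3 h Z).
Proof.
pose dS i := is_deriveZ (-2 : R) (is_derive_mulmx
  (is_derive_mulmx (is_derive_Dmx i) is_derive_invX)
  (is_derive_trmx (is_derive_Dmx i))).
apply: is_derive_eq (is_derive_summx _ dS) _; apply: eq_bigr => i _.
set D := Dmx h i Z; set I := invmx Z.1.
have -> : (- (D *m I *m h.1))^T = - (h.1 *m I *m D^T).
  by rewrite linearN /= !trmx_mul (posdef_inv_sym iZ.1) Eh mulmxA.
move: D I => D I; rewrite !(mulNmx, mulmxN, mulmxDl) !mulmxA.
move: (D *m I *m h.1 *m I *m D^T) => M.
by apply/matrixP => a b; rewrite !mxE; ring.
Qed.

End AtPoint.

(** The logarithmic derivatives P = S^-1 S' and, next, Q = X_1^-1 H_1. They satisfy P' = S^-1 S'' -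
    P^2 and Q' = - Q^2, from which the formulas for [Fhat2] and [Fhat3] follow. *)
Definition invS_schur1 h Z := invmx (schurL2 Z) *m schur1 h Z.
Definition invX_dir h Z := invmx Z.1 *m h.1.

Definition Fhat1 h Z := - \tr (invS_schur1 h Z) - \tr (invX_dir h Z).
Definition Fhat2 h Z := \tr (invS_schur1 h Z *m invS_schur1 h Z) -
  \tr (invmx (schurL2 Z) *m schur2 h Z) + \tr (invX_dir h Z *m invX_dir h Z).
Definition Fhat3 h Z := 3 * \tr (invS_schur1 h Z *m (invmx (schurL2 Z) *m schur2 h Z)) -
  2 * \tr (invS_schur1 h Z *m invS_schur1 h Z *m invS_schur1 h Z) -
  \tr (invmx (schurL2 Z) *m schur3 h Z) -
  2 * \tr (invX_dir h Z *m invX_dir h Z *m invX_dir h Z).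

Section FhatDerivatives.
Context (Z h : V).
Hypotheses (iZ : inner Z) (Eh : E h).

Lemma is_derive_invS : is_derive Z h (fun Y : V => invmx (schurL2 Y))
  (- (invS_schur1 h Z *m invmx (schurL2 Z))).
Proof.
apply: (is_derive_invmx (@inner_line R L n)) (is_derive_schur iZ Eh) => //.
  by move=> Y [_ /posdef_unit].
by apply: smooth_schurL2; [exact: inner_line|exact: inner_unit].
Qed.

Lemma is_derive_invS_schur1 : is_derive Z h (invS_schur1 h)
  (invmx (schurL2 Z) *m schur2 h Z - invS_schur1 h Z *m invS_schur1 h Z).
Proof.
apply: is_derive_eq (is_derive_mulmx is_derive_invS (is_derive_schur1 iZ Eh)) _.
by rewrite mulNmx addrC -mulmxA.
Qed.

Lemma is_derive_invX_dir :
  is_derive Z h (invX_dir h) (- (invX_dir h Z *m invX_dir h Z)).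
Proof.
apply: is_derive_eq (is_derive_mulmx (is_derive_invX iZ Eh) (is_derive_cst h.1 Z h)) _.
by rewrite mulmx0 addr0 mulNmx !mulmxA.
Qed.

Lemma is_derive_Fhat : is_derive Z h (@Fhat R L n) (Fhat1 h Z).
Proof.
have dS := is_derive_ln_det (posdef_det_gt0 iZ.2) (is_derive_schur iZ Eh).
have dX := is_derive_ln_det (posdef_det_gt0 iZ.1) (is_derive_fst Z h).
exact: (is_deriveB (is_deriveN dS) dX).
Qed.

Lemma is_derive_Fhat1 : is_derive Z h (Fhat1 h) (Fhat2 h Z).
Proof.
have dP := is_derive_mxtrace is_derive_invS_schur1.
have dQ := is_derive_mxtrace is_derive_invX_dir.
apply: is_derive_eq (is_deriveB (is_deriveN dP) dQ) _.
by rewrite /Fhat2 mxtraceD !linearN /=; ring.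
Qed.

Lemma is_derive_Fhat2 : is_derive Z h (Fhat2 h) (Fhat3 h Z).
Proof.
have dP := is_derive_invS_schur1.
have dPP := is_derive_mxtrace (is_derive_mulmx dP dP).
have dS2 := is_derive_mxtrace (is_derive_mulmx is_derive_invS (is_derive_schur2 iZ Eh)).
have dQQ := is_derive_mxtrace (is_derive_mulmx is_derive_invX_dir is_derive_invX_dir).
apply: is_derive_eq (is_deriveD (is_deriveB dPP dS2) dQQ) _.
rewrite /Fhat3 mulNmx -(mulmxA _ (invmx (schurL2 Z))).
move: (invS_schur1 h Z) (invX_dir h Z) (invmx (schurL2 Z) *m schur2 h Z) => P Q S.
rewrite mulmxBl mulmxBr mulNmx mulmxN !mulmxA !mxtraceD !linearN /=.
by rewrite (mxtrace_mulC S); ring.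
Qed.

End FhatDerivatives.

Lemma smooth_Fhat k : smooth inner E k (@Fhat R L n).
Proof.
have il := @inner_line R L n.
apply: smoothD => //; apply: smoothN => //; apply: smooth_ln => //.
- by move=> Z [_ /posdef_det_gt0].
- by apply: smooth_det => //; apply: smooth_schurL2 => //; exact: inner_unit.
- by move=> Z [/posdef_det_gt0].
- by apply: smooth_det => //; exact: smooth_fst.
Qed.

Lemma derive_Fhat Z h : inner Z -> E h -> 'D_h (@Fhat R L n) Z = Fhat1 h Z.
Proof. by move=> iZ Eh; have dF := is_derive_Fhat iZ Eh; rewrite derive_val. Qed.

(** ['D_h Fhat] is known to be [Fhat1 h] only on the cone, so the formula is transported by
    [is_derive_eq_on]. *)
Lemma derive2_Fhat Z h : inner Z -> E h -> 'D_h ('D_h (@Fhat R L n)) Z = Fhat2 h Z.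
Proof.
move=> iZ Eh.
suff dF : is_derive Z h ('D_h (@Fhat R L n)) (Fhat2 h Z) by rewrite derive_val.
apply: (is_derive_eq_on (@inner_line R L n)) (is_derive_Fhat1 iZ Eh) => // Y iY.
by rewrite derive_Fhat.
Qed.

Lemma derive3_Fhat Z h : inner Z -> E h ->
  'D_h ('D_h ('D_h (@Fhat R L n))) Z = Fhat3 h Z.
Proof.
move=> iZ Eh.
suff dF : is_derive Z h ('D_h ('D_h (@Fhat R L n))) (Fhat3 h Z) by rewrite derive_val.
apply: (is_derive_eq_on (@inner_line R L n)) (is_derive_Fhat2 iZ Eh) => // Y iY.
by rewrite derive2_Fhat.
Qed.

End Derivatives.

(** * Self-concordance *)

Section Inequalities.
Context {R : realType}.

(* With [u = a + c] and [s = sqrt (a ^+ 2 + b + c ^+ 2)] the difference of the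
   two sides is [(u - s) ^+ 2 * (u + 2 * s)]. *)
Lemma cubic_le (a b c : R) : 0 <= a -> 0 <= b -> 0 <= c ->
  2 * a ^+ 3 + 3 * a * b + 3 * c * b + 2 * c ^+ 3 <=
  2 * (a ^+ 2 + b + c ^+ 2) `^ (3%:R / 2).
Proof.
move=> a0 b0 c0; set N := a ^+ 2 + b + c ^+ 2.
have N0 : 0 <= N by rewrite !addr_ge0 ?sqr_ge0.
have -> : N `^ (3%:R / 2) = Num.sqrt N ^+ 3.
  by rewrite mulrC powRrM powR12_sqrt// powR_mulrn ?sqrtr_ge0.
set s := Num.sqrt N; have s0 : 0 <= s := sqrtr_ge0 N.
have sE : b = s ^+ 2 - a ^+ 2 - c ^+ 2 by rewrite /s sqr_sqrtr// /N; ring.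
rewrite -subr_ge0.
have -> : 2 * s ^+ 3 - (2 * a ^+ 3 + 3 * a * b + 3 * c * b + 2 * c ^+ 3) =
    (a + c - s) ^+ 2 * (a + c + 2 * s) by rewrite sE; ring.
by rewrite mulr_ge0 ?sqr_ge0// !addr_ge0// mulr_ge0.
Qed.

Context {L n : nat}.
Local Notation V := ('M[R]_L * 'M[R]_(n * L, L))%type.
Local Notation inner := (@Kl2_inner R L n).
Local Notation E := (@Espace R L n).
Implicit Types (Z h : V) (i : 'I_n).

Lemma schur1_sym Z h : E h -> (schur1 h Z)^T = schur1 h Z.
Proof.
move=> Eh; rewrite /schur1 linearB linear_sum /= Eh; congr (_ - _).
apply: eq_bigr => i _; move: (Wmx i Z) => W.
rewrite linearB linearD /= !trmx_mul !trmxK Eh mulmxA; congr (_ - _).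
exact: addrC.
Qed.

Lemma mxtrace_gram m (g M : 'M[R]_m) : \tr (g^T *m g *m M) = \tr (g *m M *m g^T).
Proof. by rewrite -mulmxA mxtrace_mulC. Qed.

Lemma mxtrace_sumZ m (c : R) (F : 'I_n -> 'M[R]_m) :
  \tr (\sum_i c *: F i) = c * \sum_i \tr (F i).
Proof. by rewrite -scaler_sumr mxtraceZ linear_sum. Qed.

(* The derivatives after congruence by the inverse Cholesky factors of the Schur
   complement (acting on its derivatives) and of X_1. *)
Record normal_form Z h := NormalForm {
  nfA : 'M[R]_L; nfC : 'M[R]_L; nfQ : 'I_n -> 'M[R]_L;
  nfA_sym : nfA^T = nfA; nfC_sym : nfC^T = nfC;
  nf1 : Fhat1 h Z = - \tr nfA - \tr nfC;
  nf2 : Fhat2 h Z = \tr (nfA *m nfA) + 2 * (\sum_i \tr (nfQ i *m (nfQ i)^T)) +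
          \tr (nfC *m nfC);
  nf3 : Fhat3 h Z = - (6 * \sum_i \tr ((nfQ i)^T *m nfA *m nfQ i)) -
          2 * \tr (nfA *m nfA *m nfA) -
          6 * (\sum_i \tr (nfQ i *m nfC *m (nfQ i)^T)) -
          2 * \tr (nfC *m nfC *m nfC) }.

(** Cyclicity of the trace distributes the factors of S^-1 and X_1^-1 so that every matrix appears
    conjugated. The factors come from existentials in [Prop], hence [inhabited]. *)
Lemma normal_form_ex Z h : inner Z -> E h -> inhabited (normal_form Z h).
Proof.
move=> [pX pS] Eh; have [g gE _] := posdef_inv_ex pS; have [j jE _] := posdef_inv_ex pX.
pose A := g *m schur1 h Z *m g^T; pose C := j *m h.1 *m j^T.
pose Q i := g *m Dmx h i Z *m j^T.
have QT i : (Q i)^T = j *m (Dmx h i Z)^T *m g^T.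
  by rewrite /Q !trmx_mul trmxK mulmxA.
have S2E : g *m schur2 h Z *m g^T = \sum_i (-2) *: (Q i *m (Q i)^T).
  rewrite /schur2 mulmx_sumr mulmx_suml; apply: eq_bigr => i _.
  by rewrite -scalemxAr -scalemxAl jE QT /Q !mulmxA.
have S3E : g *m schur3 h Z *m g^T = \sum_i 6 *: (Q i *m C *m (Q i)^T).
  rewrite /schur3 mulmx_sumr mulmx_suml; apply: eq_bigr => i _.
  by rewrite -scalemxAr -scalemxAl jE QT /Q /C !mulmxA.
have PS M : \tr (invmx (schurL2 Z) *m M) = \tr (g *m M *m g^T).
  by rewrite gE mxtrace_gram.
have QX M : \tr (invmx Z.1 *m M) = \tr (j *m M *m j^T) by rewrite jE mxtrace_gram.
have tPP : \tr (invS_schur1 h Z *m invS_schur1 h Z) = \tr (A *m A).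
  by rewrite /invS_schur1 -mulmxA PS gE /A !mulmxA.
have tPPP : \tr (invS_schur1 h Z *m invS_schur1 h Z *m invS_schur1 h Z) =
    \tr (A *m A *m A).
  by rewrite /invS_schur1 -!mulmxA PS gE /A !mulmxA.
have tQQ : \tr (invX_dir h Z *m invX_dir h Z) = \tr (C *m C).
  by rewrite /invX_dir -mulmxA QX jE /C !mulmxA.
have tQQQ : \tr (invX_dir h Z *m invX_dir h Z *m invX_dir h Z) = \tr (C *m C *m C).
  by rewrite /invX_dir -!mulmxA QX jE /C !mulmxA.
(* The factor -2 is that of [schur2]; cyclicity moves [Q i] to the right end. *)
have tPS2 : \tr (invS_schur1 h Z *m (invmx (schurL2 Z) *m schur2 h Z)) =
    -2 * \sum_i \tr ((Q i)^T *m A *m Q i).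
  have -> : \tr (invS_schur1 h Z *m (invmx (schurL2 Z) *m schur2 h Z)) =
      \tr (A *m (g *m schur2 h Z *m g^T)).
    by rewrite /invS_schur1 -mulmxA PS gE /A !mulmxA.
  rewrite S2E mulmx_sumr; under eq_bigr do rewrite -scalemxAr.
  rewrite mxtrace_sumZ; congr (_ * _); apply: eq_bigr => i _.
  by rewrite -[in RHS]mulmxA [RHS]mxtrace_mulC mulmxA.
apply: inhabits; apply: (@NormalForm _ _ A C Q).
- by rewrite /A !trmx_mul trmxK schur1_sym// mulmxA.
- by rewrite /C !trmx_mul trmxK Eh mulmxA.
- by rewrite /Fhat1 /invS_schur1 /invX_dir PS QX.
- by rewrite /Fhat2 tPP tQQ PS S2E mxtrace_sumZ; ring.
(* The first 6 is 3 times the 2 of [tPS2], the second is that of [schur3]. *)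
- by rewrite /Fhat3 tPPP tQQQ tPS2 PS S3E mxtrace_sumZ; ring.
Qed.

Section Bounds.
Context (Z h : V).
Hypotheses (iZ : inner Z) (Eh : E h).

(** A nonnegative combination of squared Frobenius norms; this is what makes the barrier convex. *)
Lemma Fhat2_ge0 : 0 <= Fhat2 h Z.
Proof.
have [[A C Q sA sC _ -> _]] := normal_form_ex iZ Eh.
rewrite -{2}sA -{2}sC !addr_ge0 ?mxtrace_sqr_ge0// mulr_ge0// sumr_ge0// => i _.
exact: mxtrace_sqr_ge0.
Qed.

(** Bounding each trace by Frobenius norms leaves [cubic_le] at [a = frob A], [b = 2 * q] and
    [c = frob C]. *)
Lemma Fhat3_le : `|Fhat3 h Z| <= 2 * (Fhat2 h Z) `^ (3%:R / 2).
Proof.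
have [[A C Q sA sC _ -> ->]] := normal_form_ex iZ Eh.
have -> : \tr (A *m A) = frob A ^+ 2 by rewrite sqr_frob sA.
have -> : \tr (C *m C) = frob C ^+ 2 by rewrite sqr_frob sC.
under [in leRHS]eq_bigr do rewrite -sqr_frob.
set q := \sum_i frob (Q i) ^+ 2.
have q0 : 0 <= q by rewrite sumr_ge0// => i _; exact: sqr_ge0.
have /cubic_le := frob_ge0 A.
move=> /(_ (2 * q) (frob C)); rewrite mulr_ge0// frob_ge0 => /(_ isT isT).
apply: le_trans.
have hA : `|\sum_i \tr ((Q i)^T *m A *m Q i)| <= frob A * q.
  rewrite mulr_sumr; apply: le_trans (ler_norm_sum _ _ _) _; apply: ler_sum => i _.
  by rewrite -(frob_tr (Q i)) -{2}(trmxK (Q i)); exact: frob_mxtrace_conj.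
have hC : `|\sum_i \tr (Q i *m C *m (Q i)^T)| <= frob C * q.
  rewrite mulr_sumr; apply: le_trans (ler_norm_sum _ _ _) _; apply: ler_sum => i _.
  exact: frob_mxtrace_conj.
have := frob_mxtrace_cube sA; have := frob_mxtrace_cube sC; move: hA hC.
rewrite !ler_norml => /andP[? ?] /andP[? ?] /andP[? ?] /andP[? ?].
by apply/andP; split; lra.
Qed.

Lemma sqr_Fhat1_le : (Fhat1 h Z) ^+ 2 <= 2 * L%:R * Fhat2 h Z.
Proof.
have [[A C Q sA sC -> -> _]] := normal_form_ex iZ Eh.
have -> : \tr (A *m A) = frob A ^+ 2 by rewrite sqr_frob sA.
have -> : \tr (C *m C) = frob C ^+ 2 by rewrite sqr_frob sC.
have q0 : 0 <= L%:R * \sum_i \tr (Q i *m (Q i)^T).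
  by rewrite mulr_ge0// sumr_ge0// => i _; exact: mxtrace_sqr_ge0.
have := sqr_mxtrace A; have := sqr_mxtrace C.
(* This square bounds the squared sum of the two traces by twice the sum of their squares, hence the
   factor 2 in the parameter. *)
have := sqr_ge0 (\tr A - \tr C); nra.
Qed.

End Bounds.
End Inequalities.

(** * Convexity from the second derivative along segments *)

Section Convexity.
Context {R : realType} {V : normedModType R}.

(** An equality of functions of [t], so that it can be applied again to ['D_h f]. *)
Lemma derive_along (f : V -> R) x h :
  'D_1 (fun t : R => f (t *: h + x)) = (fun t => 'D_h f (t *: h + x)).
Proof.
apply/funext => t; rewrite /derive.
set g1 := fun s => s^-1 *: _; set g2 := fun s => s^-1 *: _; suff -> : g1 = g2 by [].
by apply/funext => s; rewrite /g1 /g2 /= [_%:A]mulr1 scalerDl addrA.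
Qed.

Lemma derivable_along (f : V -> R) x h t :
  derivable f (t *: h + x) h -> derivable (fun t : R => f (t *: h + x)) t 1.
Proof.
rewrite /derivable; set g1 := fun s => s^-1 *: _; set g2 := fun s => s^-1 *: _.
suff -> : g1 = g2 by [].
by apply/funext => s; rewrite /g1 /g2 /= [_%:A]mulr1 scalerDl addrA.
Qed.

Lemma convex_along (f : V -> R) x h :
  (forall t : R, 0 <= t <= 1 -> derivable f (t *: h + x) h) ->
  (forall t : R, 0 <= t <= 1 -> derivable ('D_h f) (t *: h + x) h) ->
  (forall t : R, 0 <= t <= 1 -> 0 <= 'D_h ('D_h f) (t *: h + x)) ->
  forall t : R, 0 <= t <= 1 ->
    f (t *: h + x) <= (1 - t) * f x + t * f (h + x).
Proof.
move=> df ddf ddf0 t /andP[t0 t1].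
pose phi (t : R) := f (t *: h + x).
have cphi (s : R) : 0 <= s <= 1 -> {for s, continuous phi}.
  move=> /df/derivable_along/derivable1_diffP; exact: differentiable_continuous.
have oo (s : R) : s \in `]0, 1[ -> 0 <= s <= 1.
  by rewrite in_itv /= => /andP[s0 s1]; rewrite !ltW.
have dphi : 'D_1 phi = (fun s => 'D_h f (s *: h + x)) := derive_along f x h.
have ddphi : 'D_1 ('D_1 phi) = (fun s => 'D_h ('D_h f) (s *: h + x)).
  by rewrite dphi; exact: (derive_along ('D_h f) x h).
have t01 : 0 <= 1 - t by rewrite subr_ge0.
have t11 : 1 - t <= 1 by rewrite gerBl.
have phi0 : phi 0 = f x by rewrite /phi scale0r add0r.
have phi1 : phi 1 = f (h + x) by rewrite /phi scale1r.
rewrite -phi0 -phi1 -/(phi t).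
(* The interval parameter is the weight of the left endpoint, hence [1 - t]. *)
have := @second_derivative_convex R phi 0 1 _ _ _ _ _ (Itv01 t01 t11) ler01.
rewrite !convRE /= /unstable.onem subKr mulr0 add0r mulr1; apply.
- move=> s /andP[s0 s1].
  have -> : 'D_1 ('D_1 phi) s = 'D_h ('D_h f) (s *: h + x).
    exact: (congr1 (fun g => g s) ddphi).
  by apply: ddf0; rewrite !ltW.
- by apply: cvg_at_left_filter; apply: cphi; rewrite ler01 lexx.
- by apply: cvg_at_right_filter; apply: cphi; rewrite ler01 lexx.
- by move=> s /oo /df; exact: derivable_along.
- by move=> s /oo /ddf; rewrite dphi; exact: derivable_along.
Qed.

End Convexity.

(** * Assembly of smoothness, convexity, blow-up and the two differential inequalities *)

Theorem mainTheorem4 (R : realType) (L m : nat) (hL : (1 <= L)%N) (hm : (2 <= m)%N) :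
  relint (@Espace R L (m - 1)) (@Kl2 R L (m - 1)) = @Kl2_inner R L (m - 1) /\
  self_concordant_barrier (@Espace R L (m - 1)) (@Kl2 R L (m - 1))
    (@Fhat R L (m - 1)) (2 * L%:R).
Proof.
split; first exact: relint_Kl2.
(* From here on every condition is stated on the open cone, where both matrices are positive
   definite. *)
rewrite /self_concordant_barrier relint_Kl2.
have [c0 s1] := @smooth_Fhat R L (m - 1) 3.
split.
- split=> //; split=> [h Eh x Dx|]; first by case: (s1 h Eh) => /(_ x Dx).
  split=> [h Eh|]; first by case: (s1 h Eh) => _ [].
  split=> [h k Eh Ek x Dx|].
    by case: (s1 h Eh) => _ [_ /(_ k Ek)[/(_ x Dx)]].
  split=> [h k Eh Ek|].
    by case: (s1 h Eh) => _ [_ /(_ k Ek)[_ []]].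
  split=> [h k l Eh Ek El x Dx|h k l Eh Ek El].
    by case: (s1 h Eh) => _ [_ /(_ k Ek)[_ [_ /(_ l El)[/(_ x Dx)]]]].
  by case: (s1 h Eh) => _ [_ /(_ k Ek)[_ [_ /(_ l El)[_ []]]]].
- move=> x y t ix iy t01; set h := y - x.
  have Eh : @Espace R L (m - 1) h.
    rewrite /h -[y]scale1r -scaleN1r.
    by apply: Espace_lin; exact: inner_sub.
  have pE (s : R) : s *: h + x = (1 - s) *: x + s *: y.
    by rewrite /h scalerBr scalerBl scale1r addrC addrA addrAC.
  (* The segment stays in the cone, so the derivative formulas hold along all of it. *)
  have ih (s : R) : 0 <= s <= 1 -> Kl2_inner (s *: h + x).
    move=> /andP[s0 s1']; rewrite pE; apply: inner_cone => //.
      by rewrite subr_ge0.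
    by rewrite subrK.
  have yE : y = h + x by rewrite /h subrK.
  rewrite -pE {1}yE; apply: convex_along => // s s01.
  + by case: (s1 h Eh) => /(_ _ (ih s s01)).
  + by case: (s1 h Eh) => _ [_ /(_ h Eh)[/(_ _ (ih s s01))]].
  + by rewrite derive2_Fhat; [exact: Fhat2_ge0 (ih s s01) Eh|exact: ih|].
- move=> u x iu clx nx ux; apply: Fhat_barrier ux => //; apply: Kl2_sub.
  by move: clx; rewrite /Kl2 -(closure_id _).1//; exact: closed_closure.
- by move=> x h ix Eh; rewrite derive3_Fhat// derive2_Fhat//; exact: Fhat3_le.
- by move=> x h ix Eh; rewrite derive_Fhat// derive2_Fhat//; exact: sqr_Fhat1_le.
Qed.
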